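(* Consider the closed-loop power network system (network dynamics, generation dynamics, DADOC controller and generation input) described in the context. Let $\beta^*=(\eta^*,\omega^*,x^{M,*},p^{c,*})$ be an equilibrium of this system such that $|\eta^*_{ij}|<\tfrac{\pi}{2}$ for all $(i,j)\in E$. Suppose that the Design condition stated in the context holds at every $j\in G$ and that $k_{c,j}=\frac{1}{q_jK_j}$ for all $j\in G$. Then there exists an open neighborhood of initial conditions $(\eta(0),\omega^G(0),x^M(0),p^c(0))$ about this equilibrium such that every solution of the closed-loop system starting in this neighborhood asymptotically converges to a global minimum of the OGR problem with nominal frequency; that is, as $t\to\infty$, $p^M(t)=(p^M_j(t))_{j\in G}$ converges to a global minimum of $$\min_{p^M}\ \sum_{j\in G}\tfrac12 q_j(p^M_j)^2\quad\text{subject to}\quad \sum_{j\in G}p^M_j=\sum_{j\in N}p^L_j,$$ and $\omega(t)\to \mathbf 0_{|N|}$.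
   Context: **Network.** $(N,E)$ is a connected graph, $N=\{1,\dots,|N|\}$ the buses, $E\subseteq N\times N$ the lines, each line given one arbitrary direction (if $(i,j)\in E$ then $(j,i)\notin E$). $N$ is the disjoint union of $G=\{1,\dots,|G|\}$ (buses with inertia, nonempty) and $L=\{|G|+1,\dots,|N|\}$ (buses without inertia). $i:i\to j$ and $k:j\to k$ denote the predecessors and successors of bus $j$ in $(N,E)$. Constants: $M_j>0$ ($j\in G$), $\Lambda_j>0$ ($j\in N$), $B_{ij}=B_{ji}>0$ ($(i,j)\in E$), demands $p^L_j\in\mathbb R$ ($j\in N$), cost coefficients $q_j>0$ ($j\in G$). **Network dynamics.** $\dot\eta_{ij}=\omega_i-\omega_j$ for $(i,j)\in E$; $M_j\dot\omega_j=-p^L_j+p^M_j-\Lambda_j\omega_j-\sum_{k:j\to k}p_{jk}+\sum_{i:i\to j}p_{ij}$ for $j\in G$; $0=-p^L_j-\Lambda_j\omega_j-\sum_{k:j\to k}p_{jk}+\sum_{i:i\to j}p_{ij}$ for $j\in L$; $p_{ij}=B_{ij}\sin\eta_{ij}$ for $(i,j)\in E$. **Generation dynamics.** For $j\in G$: $\dot x^M_j=A_jx^M_j+B_ju_j$, $p^M_j=C_jx^M_j+D_ju_j$, with $x^M_j(t)\in\mathbb R^{n_j}$, $n_j\ge 0$, $u_j(t),p^M_j(t)\in\mathbb R$, $A_j\in\mathbb R^{n_j\times n_j}$ Hurwitz, $B_j\in\mathbb R^{n_j}$, $C_j\in\mathbb R^{1\times n_j}$, $D_j\in\mathbb R$.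 Put $K_j=-C_jA_j^{-1}B_j+D_j$ (static gain). **DADOC controller.** $(G,\tilde E)$ is a connected (undirected) communication graph. For $j\in G$: $\gamma_j\dot p^c_j=p^M_j-K_ju_j-k_{f,j}\omega_j+\sum_{i:(i,j)\in\tilde E}\alpha_{ij}(p^c_i-p^c_j)$, $\quad u_j=k_{c,j}p^c_j-k_{d,j}\omega_j$, where the sum is over the neighbors $i$ of $j$ in $(G,\tilde E)$, and $\gamma_j,k_{f,j},k_{c,j},k_{d,j}>0$, $\alpha_{ij}=\alpha_{ji}>0$ are constants. The state of the closed-loop system is $(\eta,\omega^G,x^M,p^c)$ with $\omega^G=(\omega_j)_{j\in G}$; $\omega_j$ for $j\in L$ is determined by the algebraic equation. An equilibrium is a point $\beta^*=(\eta^*,\omega^*,x^{M,*},p^{c,*})$ at which all time derivatives vanish (and the algebraic equations hold). **Design condition (at bus $j\in G$).** There exist a matrix $P_j=P_j^T>0$ and a real number $\hat\Lambda_j<\Lambda_j$ such that $$\begin{bmatrix}-K_jk_{c,j}+D_jk_{c,j} & r_j^T\\ r_j&\hat Q_j\end{bmatrix}\le 0\ \text{(negative semidefinite)},$$ where $$r_j=\begin{bmatrix}\frac{k_{c,j}B_j^TP_j+C_j}{2} & \frac{k_{f,j}-k_{d,j}K_j+D_jk_{d,j}-D_jk_{c,j}}{2}\end{bmatrix}^T,\qquad \hat Q_j=\begin{bmatrix}\frac{P_jA_j+A_j^TP_j}{2}&\frac{k_{d,j}P_jB_j-C_j^T}{2}\\ \frac{k_{d,j}B_j^TP_j-C_j}{2}&-\hat\Lambda_j-D_jk_{d,j}\end{bmatrix}.$$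 *)

(* Defs.v *)
From HB Require Import structures.
From mathcomp Require Import all_boot all_order all_algebra.
From mathcomp Require Import complex.
From mathcomp Require Import all_classical all_reals all_analysis.

Set Implicit Arguments.
Unset Strict Implicit.
Unset Printing Implicit Defensive.

Import Order.TTheory GRing.Theory Num.Theory.
Import numFieldNormedType.Exports.

Local Open Scope classical_set_scope.
Local Open Scope ring_scope.

Definition hurwitz (R : realType) (n : nat) (A : 'M[R]_n) : Prop :=
  forall z : R[i], eigenvalue (map_mx (real_complex R) A) z -> complex.Re z < 0.

Definition posdef (R : realType) (n : nat) (P : 'M[R]_n) : Prop :=
  P^T = P /\ forall v : 'cV[R]_n, v != 0 -> 0 < (v^T *m P *m v) 0 0.

Definition negsemidef (R : realType) (n : nat) (Q : 'M[R]_n) : Prop :=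
  Q^T = Q /\ forall v : 'cV[R]_n, (v^T *m Q *m v) 0 0 <= 0.

(* The buses are 'I_(g + l): the buses with inertia are the [lshift l j],
   j : 'I_g, and the buses without inertia are the [rshift g j], j : 'I_l. *)
Record network (R : realType) (g l : nat) := Network {
  lines : {set 'I_(g + l) * 'I_(g + l)};
  lines_asym : forall i j, (i, j) \in lines -> (j, i) \notin lines;
  lines_connected : forall i j,
    connect (fun a b => ((a, b) \in lines) || ((b, a) \in lines)) i j;
  inertia : 'I_g -> R;
  inertia_gt0 : forall j, 0 < inertia j;
  damping : 'I_(g + l) -> R;
  damping_gt0 : forall j, 0 < damping j;
  suscept : 'I_(g + l) -> 'I_(g + l) -> R;
  suscept_sym : forall i j, (i, j) \in lines -> suscept i j = suscept j i;
  suscept_gt0 : forall i j, (i, j) \in lines -> 0 < suscept i j;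
  demand : 'I_(g + l) -> R
}.

Record generation (R : realType) (g : nat) := Generation {
  dimx : 'I_g -> nat;
  mxA : forall j, 'M[R]_(dimx j);
  mxB : forall j, 'cV[R]_(dimx j);
  mxC : forall j, 'rV[R]_(dimx j);
  mxD : 'I_g -> R;
  mxA_hurwitz : forall j, hurwitz (mxA j)
}.

Definition static_gain (R : realType) (g : nat) (gen : generation R g)
    (j : 'I_g) : R :=
  - (mxC gen j *m invmx (mxA gen j) *m mxB gen j) 0 0 + mxD gen j.

Record controller (R : realType) (g : nat) := Controller {
  comm : rel 'I_g;
  comm_sym : symmetric comm;
  comm_connected : forall i j, connect comm i j;
  alpha : 'I_g -> 'I_g -> R;
  alpha_sym : forall i j, comm i j -> alpha i j = alpha j i;
  alpha_gt0 : forall i j, comm i j -> 0 < alpha i j;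
  gam : 'I_g -> R;
  gam_gt0 : forall j, 0 < gam j;
  kf : 'I_g -> R;
  kf_gt0 : forall j, 0 < kf j;
  kc : 'I_g -> R;
  kc_gt0 : forall j, 0 < kc j;
  kd : 'I_g -> R;
  kd_gt0 : forall j, 0 < kd j
}.

Section closed_loop_system.
Variables (R : realType) (g l : nat).
Variables (nw : network R g l) (gen : generation R g) (ctl : controller R g).

Definition line : Type := {e : 'I_(g + l) * 'I_(g + l) | e \in lines nw}.

(* Values of all the variables of the closed loop, with the frequencies of the
   buses without inertia, which are not state variables, included. *)
Record configuration := Configuration {
  angle : line -> R;
  freq : 'I_(g + l) -> R;
  xM : forall j : 'I_g, 'cV[R]_(dimx gen j);
  pc : 'I_g -> R
}.

Definition state : topologicalType :=
  (prod_topology (fun _ : line => R : topologicalType)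
   * prod_topology (fun _ : 'I_g => R : topologicalType)
   * prod_topology (fun j : 'I_g => 'cV[R]_(dimx gen j) : topologicalType)
   * prod_topology (fun _ : 'I_g => R : topologicalType))%type.

Definition state_of (b : configuration) : state :=
  (angle b, (fun j => freq b (lshift l j)), xM b, pc b).

Definition flow (b : configuration) (e : line) : R :=
  suscept nw (val e).1 (val e).2 * sin (angle b e).

Definition net_flow (b : configuration) (j : 'I_(g + l)) : R :=
  - \sum_(e : line | (val e).1 == j) flow b e
  + \sum_(e : line | (val e).2 == j) flow b e.

Definition input (b : configuration) (j : 'I_g) : R :=
  kc ctl j * pc b j - kd ctl j * freq b (lshift l j).

Definition pM (b : configuration) (j : 'I_g) : R :=
  (mxC gen j *m xM b j) 0 0 + mxD gen j * input b j.

Definition algebraic_eqs (b : configuration) : Prop :=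
  forall k : 'I_l, let j := rshift g k in
    0 = - demand nw j - damping nw j * freq b j + net_flow b j.

(* The differential equations, relating the values [b] of the variables to the
   time derivatives [dangle], [dfreq], [dx], [dpc] of the state variables. *)
Definition differential_eqs (b : configuration) (dangle : line -> R)
    (dfreq : 'I_g -> R) (dx : forall j : 'I_g, 'cV[R]_(dimx gen j))
    (dpc : 'I_g -> R) : Prop :=
  [/\ forall e, dangle e = freq b (val e).1 - freq b (val e).2,
      forall k : 'I_g, let j := lshift l k in
        inertia nw k * dfreq k =
          - demand nw j + pM b k - damping nw j * freq b j + net_flow b j,
      forall j, dx j = mxA gen j *m xM b j + input b j *: mxB gen j
    & forall j, gam ctl j * dpc j =
        pM b j - static_gain gen j * input b j
        - kf ctl j * freq b (lshift l j)
        + \sum_(i | comm ctl j i) alpha ctl i j * (pc b i - pc b j)].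

Definition equilibrium (b : configuration) : Prop :=
  algebraic_eqs b /\
  differential_eqs b (fun=> 0) (fun=> 0) (fun=> 0) (fun=> 0).

(* A solution on [0, +oo[: only the values [z t] for [0 <= t] matter; the
   state is continuous up to the initial time and the differential equations
   hold at every positive time. *)
Definition solution (z : R -> configuration) : Prop :=
  [/\ {within `[0, +oo[, continuous (state_of \o z)},
      forall t, 0 <= t -> algebraic_eqs (z t)
    & forall t, 0 < t ->
      [/\ forall e, derivable (fun s => angle (z s) e) t 1,
          forall j, derivable (fun s => freq (z s) (lshift l j)) t 1,
          forall j, derivable (fun s => xM (z s) j) t 1,
          forall j, derivable (fun s => pc (z s) j) t 1
        & differential_eqs (z t)
            (fun e => 'D_1 (fun s => angle (z s) e) t)
            (fun j => 'D_1 (fun s => freq (z s) (lshift l j)) t)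
            (fun j => 'D_1 (fun s => xM (z s) j) t)
            (fun j => 'D_1 (fun s => pc (z s) j) t)]].

Section design.
Variable j : 'I_g.
Let n := dimx gen j.
Let A : 'M[R]_n := mxA gen j.
Let B : 'cV[R]_n := mxB gen j.
Let C : 'rV[R]_n := mxC gen j.
Let D := mxD gen j.
Let K := static_gain gen j.
Let k_c := kc ctl j.
Let k_d := kd ctl j.
Let k_f := kf ctl j.

Definition design_r (P : 'M[R]_n) : 'cV[R]_(n + 1) :=
  (row_mx (2^-1 *: (k_c *: (B^T *m P) + C))
          (2^-1 * (k_f - k_d * K + D * k_d - D * k_c))%:M)^T.

Definition design_Q (P : 'M[R]_n) (hLambda : R) : 'M[R]_(n + 1) :=
  block_mx (2^-1 *: (P *m A + A^T *m P))
           (2^-1 *: (k_d *: (P *m B) - C^T))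
           (2^-1 *: (k_d *: (B^T *m P) - C))
           (- hLambda - D * k_d)%:M.

Definition design_mx (P : 'M[R]_n) (hLambda : R) : 'M[R]_(1 + (n + 1)) :=
  block_mx (- K * k_c + D * k_c)%:M (design_r P)^T
           (design_r P) (design_Q P hLambda).

Definition design_condition : Prop :=
  exists (P : 'M[R]_n) (hLambda : R),
    [/\ posdef P, hLambda < damping nw (lshift l j)
      & negsemidef (design_mx P hLambda)].

End design.

Definition OGR_feasible (p : 'I_g -> R) : Prop :=
  \sum_(j < g) p j = \sum_(j < g + l) demand nw j.

Definition OGR_cost (q p : 'I_g -> R) : R :=
  \sum_(j < g) 2^-1 * q j * p j ^+ 2.

Definition OGR_minimum (q p : 'I_g -> R) : Prop :=
  OGR_feasible p /\
  forall p', OGR_feasible p' -> OGR_cost q p <= OGR_cost q p'.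

End closed_loop_system.

(* Main.v *)
(* The energy [energy], which adds to the usual network energy around the
   equilibrium the storage [1/2 x^T P x] of the generation dynamics and
   [1/2 gam pc^2] of the controllers, decreases along every solution: the design
   matrix inequality is exactly what bounds its derivative by minus a positive
   definite function of all the frequencies and of the differences of [pc]
   between neighbors.  As the equilibrium angles are less than [pi / 2], a
   sublevel set of the energy confines nearby solutions, so every quantity stays
   bounded with a bounded derivative.

   Barbalat's lemma then replaces LaSalle's principle: the frequencies and the
   differences of [pc] tend to 0, and so do their derivatives.  Adding up the
   power balance of all the buses, the common value [c] of the [pc] satisfies
   [G c' + S c -> sum of the demands], with [S] the sum of the [1 / q j] and [G]
   the sum of the [gam j].  This stable scalar equation forces [c] to converge to
   [sum of the demands / S] and [c'] to 0, whence [pM j] tends to [lim c / q j],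
   the point where all marginal costs [q j * pM j] agree. *)

Require Import Defs.
From HB Require Import structures.
From mathcomp Require Import all_boot all_order all_algebra.
From mathcomp Require Import complex.
From mathcomp Require Import all_classical all_reals all_analysis.
From mathcomp Require Import ring lra.
Import Order.TTheory GRing.Theory Num.Theory.
Import numFieldNormedType.Exports.
Local Open Scope classical_set_scope.
Local Open Scope ring_scope.

Set Implicit Arguments.
Unset Strict Implicit.
Unset Printing Implicit Defensive.

(** * Functions of time with bounded derivatives *)

Section RealAnalysis.
Variable R : realType.
Implicit Types (f g w : R -> R) (s t a b c d e l K L : R).

Lemma is_derive_bigsum (I : Type) (r : seq I) (P : pred I)
    (F : I -> R -> R) (dF : I -> R) (t : R) :
  (forall i, is_derive t (1 : R) (F i) (dF i)) ->
  is_derive t (1 : R) (fun s => \sum_(i <- r | P i) F i s)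
    (\sum_(i <- r | P i) dF i).
Proof.
move=> dFi; rewrite -fct_sumE.
by elim/big_ind2 : _ => // [|] *; [exact: is_derive_cst|exact: is_deriveD].
Qed.

Lemma derivative_segment f g (a b : R) : a <= b ->
  (forall t, t \in `[a, b]%R -> is_derive t (1 : R) f (g t)) ->
  exists2 c, c \in `[a, b]%R & f b - f a = g c * (b - a).
Proof.
move=> ab dfg.
have dfo x : x \in `]a, b[%R -> is_derive x (1 : R) f (g x).
  by move=> xab; apply: dfg; move: xab; rewrite !in_itv/= => /andP[/ltW-> /ltW->].
have cf : {within `[a, b], continuous f}.
  by apply: derivable_within_continuous => x xab; have [] := dfg x xab.
exact: (@MVT_segment _ f g a b ab dfo cf).
Qed.

Lemma derivative_nonincreasing f g (a : R) :
  {within `[a, +oo[, continuous f} ->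
  (forall t, a < t -> is_derive t (1 : R) f (g t)) ->
  (forall t, a < t -> g t <= 0) ->
  forall s t, a <= s -> s <= t -> f t <= f s.
Proof.
move=> cf dfg g0; apply: ler0_derive1_nincry => // x; rewrite in_itv/= andbT => ax.
  by have [] := dfg _ ax.
by rewrite derive1E; have /@derive_val -> := dfg _ ax; exact: g0.
Qed.

(** * Bounded functions of positive time, and functions with a bounded derivative *)

Definition bounded_pos f := exists K, forall t, 0 < t -> `|f t| <= K.

Lemma bounded_pos_cst c : bounded_pos (fun=> c).
Proof. by exists `|c|. Qed.

Lemma bounded_posD f g : bounded_pos f -> bounded_pos g ->
  bounded_pos (fun t => f t + g t).
Proof.
move=> [K fK] [L gL]; exists (K + L) => t t0.
by rewrite (le_trans (ler_normD _ _))// lerD ?fK ?gL.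
Qed.

Lemma bounded_posN f : bounded_pos f -> bounded_pos (fun t => - f t).
Proof. by move=> [K fK]; exists K => t t0; rewrite normrN fK. Qed.

Lemma bounded_posM f g : bounded_pos f -> bounded_pos g ->
  bounded_pos (fun t => f t * g t).
Proof.
move=> [K fK] [L gL]; exists (K * L) => t t0.
by rewrite normrM ler_pM// ?fK ?gL.
Qed.

Lemma bounded_pos_sum (I : Type) (r : seq I) (P : pred I) (F : I -> R -> R) :
  (forall i, bounded_pos (F i)) ->
  bounded_pos (fun t => \sum_(i <- r | P i) F i t).
Proof.
move=> bF; elim: r => [|i r IH].
  by under eq_fun do rewrite big_nil; exact: bounded_pos_cst.
under eq_fun do rewrite big_cons.
by case: (P i) => //; exact: bounded_posD.
Qed.

Lemma bounded_pos_square f a c K : 0 < c ->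
  (forall t, 0 < t -> c * (f t - a) ^+ 2 <= K) -> bounded_pos f.
Proof.
(* The bound comes from [x <= 1 + x ^+ 2], which avoids a square root. *)
move=> c0 fK; exists (`|a| + 1 + K / c) => t t0.
rewrite -[f t](subrK a) addrC (le_trans (ler_normD _ _))//.
rewrite -addrA lerD2l; set x := f t - a.
have x2 : `|x| ^+ 2 <= K / c.
  by rewrite real_normK ?num_real// ler_pdivlMr// mulrC fK.
by have := normr_ge0 x; nra.
Qed.

(** This is the regularity that Barbalat's lemma consumes: a bounded derivative gives uniform
    continuity, and bounding [f] as well makes the class closed under products. The derivative is
    given by a witness, so that closure proofs need only the differentiation rules. *)
Definition tame f := exists K, forall t, 0 < t ->
  `|f t| <= K /\ exists2 f', is_derive t (1 : R) f f' & `|f'| <= K.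

Lemma tameI f g : bounded_pos f ->
  (forall t, 0 < t -> is_derive t (1 : R) f (g t)) ->
  bounded_pos g -> tame f.
Proof.
move=> [K fK] dfg [L gL]; exists (Num.max K L) => t t0; split.
  by rewrite le_max fK.
by exists (g t); [exact: dfg|rewrite le_max gL ?orbT].
Qed.

Lemma tame_cst (c : R) : tame (fun=> c).
Proof.
exists `|c| => t _; split=> //.
by exists 0; [exact: is_derive_cst|rewrite normr0].
Qed.

Lemma tameD f g : tame f -> tame g -> tame (fun t => f t + g t).
Proof.
move=> [K fK] [L gL]; exists (K + L) => t t0.
have [fk [f' df f'K]] := fK _ t0; have [gl [g' dg g'L]] := gL _ t0.
split; first by rewrite (le_trans (ler_normD _ _))// lerD.
exists (f' + g'); first exact: is_deriveD.
by rewrite (le_trans (ler_normD _ _))// lerD.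
Qed.

Lemma tameM f g : tame f -> tame g -> tame (fun t => f t * g t).
Proof.
move=> [K fK] [L gL]; exists (K * L + L * K) => t t0.
have [fk [f' df f'K]] := fK _ t0; have [gl [g' dg g'L]] := gL _ t0.
have K0 := le_trans (normr_ge0 _) fk; have L0 := le_trans (normr_ge0 _) gl.
split.
  by rewrite normrM (le_trans (ler_pM _ _ fk gl))// lerDl mulr_ge0.
exists (f t * g' + g t * f'); first exact: is_deriveM.
by rewrite (le_trans (ler_normD _ _))// lerD// normrM ler_pM.
Qed.

Lemma tameN f : tame f -> tame (fun t => - f t).
Proof.
move=> [K fK]; exists K => t /fK[fk [f' df f'K]]; rewrite normrN; split=> //.
by exists (- f'); [exact: is_deriveN|rewrite normrN].
Qed.

Lemma tameB f g : tame f -> tame g -> tame (fun t => f t - g t).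
Proof. by move=> tf tg; apply: tameD => //; exact: tameN. Qed.

Lemma tame_sum (I : Type) (r : seq I) (P : pred I) (F : I -> R -> R) :
  (forall i, tame (F i)) -> tame (fun t => \sum_(i <- r | P i) F i t).
Proof.
move=> tF; elim: r => [|i r IH].
  by under eq_fun do rewrite big_nil; exact: tame_cst.
under eq_fun do rewrite big_cons.
by case: (P i) => //; exact: tameD.
Qed.

Lemma tame_sin f : tame f -> tame (fun t => sin (f t)).
Proof.
move=> [K fK]; exists (Num.max 1 K) => t /fK[fk [f' df f'K]]; split.
  by rewrite le_max ler_norml sin_geN1 sin_le1.
exists (cos (f t) * f').
  by apply: (@is_derive1_comp _ sin f); exact: is_derive_sin.
rewrite le_max normrM; apply/orP; right; rewrite (le_trans _ f'K)//.
by rewrite ler_piMl// ler_norml cos_geN1 cos_le1.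
Qed.

(** Differentiability at [t] transfers because a positive [t] has a whole neighborhood of positive
    times. It serves for the frequencies of the buses without inertia, whose algebraic equation is
    known only from time 0 on. *)
Lemma eq_tame f g : (forall t, 0 < t -> f t = g t) -> tame f -> tame g.
Proof.
move=> fg [K fK]; exists K => t t0; have [fk [f' df f'K]] := fK _ t0.
rewrite -fg//; split=> //; exists f' => //; apply: near_eq_is_derive df.
by near=> s; apply: fg; near: s; exact: lt_nbhsr.
Unshelve. all: by end_near. Qed.

(* If [w t >= e], the Lipschitz bound keeps [w >= e / 2] on an interval after
   [t] of a length independent of [t], over which [f] increases by a fixed
   amount. *)
Lemma barbalat f w (l : R) : f t @[t --> +oo] --> l -> tame w ->
  (forall t, 0 < t -> exists2 f', is_derive t (1 : R) f f' & w t <= f') ->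
  forall e, 0 < e -> \forall t \near +oo, w t < e.
Proof.
move=> fl [K wK] dfw e e0.
have K0 : 0 <= K by have [] := wK 1 ltr01 => /(le_trans (normr_ge0 _)).
(* Over a time [d] the function [w] loses at most [K * d = e / 2 - d], so it stays above [e / 2];
   the [+ 1] covers [K = 0]. *)
pose d := e / (2 * (K + 1)).
have K1 : 0 < K + 1 by lra.
have d0 : 0 < d by rewrite divr_gt0// mulr_gt0.
(* Late values of [f] are within [e * d / 4] of [l], hence differ by less than [e * d / 2], while
   [w >= e / 2] would make [f] grow by at least that much over a time [d]. *)
have ed0 : 0 < e * d / 4 by rewrite divr_gt0// mulr_gt0.
have [T [_ fT]] := (cvgrPdist_lt _ _).1 fl _ ed0.
near=> t.
have t0 : 0 < t by near: t; apply: nbhs_pinfty_gt; exact: num_real.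
have tT : T < t by near: t; apply: nbhs_pinfty_gt; exact: num_real.
rewrite ltNge; apply/negP => ew.
have td : t <= t + d by rewrite lerDl ltW.
have dw s : 0 < s -> is_derive s (1 : R) w ('D_1 w s).
  by move=> /wK[_ [w' [dws _] _]]; exact: derivableP.
have df s : 0 < s -> is_derive s (1 : R) f ('D_1 f s).
  by move=> /dfw[f' [dfs _] _]; exact: derivableP.
have w'K s : 0 < s -> `|'D_1 w s| <= K.
  by move=> /wK[_ [w' /@derive_val ->]].
have f'w s : 0 < s -> w s <= 'D_1 f s.
  by move=> /dfw[w' /@derive_val ->].
have gt0 a b s : 0 < a -> s \in `[a, b]%R -> 0 < s.
  by move=> a0; rewrite in_itv/= => /andP[/(lt_le_trans a0)].
have [c ci fc] := derivative_segment td (fun s si => df s (gt0 _ _ _ t0 si)).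
have c0 := gt0 _ _ _ t0 ci.
move: ci; rewrite in_itv/= => /andP[tc ctd].
have [b bi wb] := derivative_segment tc (fun s si => dw s (gt0 _ _ _ t0 si)).
have b0 := gt0 _ _ _ t0 bi.
have := w'K _ b0; rewrite ler_norml => /andP[wKl _].
have wc : e / 2 <= w c.
  have : - (K * d) <= w c - w t.
    rewrite wb -mulNr (@le_trans _ _ (- K * (c - t)))//.
      by rewrite ler_wnM2l ?oppr_le0//; lra.
    by rewrite ler_wpM2r// subr_ge0.
  have -> : K * d = e / 2 - d by rewrite /d; field; lra.
  lra.
have := f'w _ c0 => fw.
have : e / 2 * d <= f (t + d) - f t.
  by rewrite fc addrAC subrr add0r ler_wpM2r ?(ltW d0)// (le_trans wc).
have := fT _ tT; have := fT (t + d); rewrite /= (lt_le_trans tT)// => /(_ isT).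
rewrite !ltr_norml => /andP[? ?] /andP[? ?].
have -> : e / 2 * d = 2 * (e * d / 4) by field.
lra.
Unshelve. all: by end_near. Qed.

(** Barbalat's lemma applied to [f] and to [- f] bounds [g] from both sides. *)
Lemma derivative_cvg0 f g (l : R) : f t @[t --> +oo] --> l -> tame g ->
  (forall t, 0 < t -> is_derive t (1 : R) f (g t)) -> g t @[t --> +oo] --> 0.
Proof.
move=> fl tg dfg; apply/cvgrPdist_lt => e e0; near=> t.
rewrite sub0r normrN ltr_norml ltrNl; apply/andP; split; near: t.
  apply: (@barbalat (fun t => - f t) _ (- l)) => //; first exact: cvgN.
    exact: tameN.
  by move=> t /dfg df; exists (- g t) => //; exact: is_deriveN.
by apply: (@barbalat f _ l) => // t /dfg; exists (g t).
Unshelve. all: by end_near. Qed.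

(** Barbalat's lemma for [c * w ^+ 2]. In the application [f] is minus the energy and [c * w ^+ 2]
    is one of the dissipated quantities. *)
Lemma square_cvg0 f w c l : 0 < c -> f t @[t --> +oo] --> l -> tame w ->
  (forall t, 0 < t ->
    exists2 f', is_derive t (1 : R) f f' & c * w t ^+ 2 <= f') ->
  w t @[t --> +oo] --> 0.
Proof.
move=> c0 fl tw dfw; apply/cvgrPdist_lt => e e0.
have tw2 : tame (fun t => c * w t ^+ 2).
  apply: tameM; first exact: tame_cst.
  by under eq_fun do rewrite expr2; exact: tameM.
have ce0 : 0 < c * e ^+ 2 by rewrite mulr_gt0// exprn_gt0.
apply: filterS (barbalat fl tw2 dfw ce0) => t; rewrite ltr_pM2l//.
rewrite sub0r normrN => we.
by rewrite -(ltr_pXn2r (ltn0Sn 1)) ?nnegrE ?(ltW e0)// real_normK ?num_real.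
Qed.

(** The integrating factor [expR (a * t)] turns [f - c], with [c] slightly above [b / a], into the
    function [H], which is eventually nonincreasing. Hence [f - c] is at most a constant times a
    decaying exponential. *)
Lemma linear_ode_lt f g (a b e : R) : 0 < a -> 0 < e ->
  (forall t, 0 < t -> is_derive t (1 : R) f (g t)) ->
  (g t + a * f t) @[t --> +oo] --> b -> \forall t \near +oo, f t < b / a + e.
Proof.
move=> a0 e0 dfg gfb.
have ae0 : 0 < a * (e / 2) by rewrite mulr_gt0// divr_gt0.
have [T0 [_ gT]] := (cvgrPdist_lt _ _).1 gfb _ ae0.
pose T := Num.max T0 0.
pose c := b / a + e / 2.
pose H t := expR (a * t) * (f t - c).
have dH t : T < t -> is_derive t (1 : R) H (expR (a * t) * (g t + a * f t - a * c)).
  rewrite gt_max => /andP[Tt t0].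
  have da : is_derive t (1 : R) (fun s => expR (a * s)) (expR (a * t) * a).
    apply: (@is_derive1_comp _ expR (fun s => a * s)).
    by apply: is_derive_eq (is_deriveZ _ _) _; rewrite /GRing.scale/= mulr1.
  have df : is_derive t (1 : R) (fun s => f s - c) (g t).
    apply: is_derive_eq (is_deriveB (dfg _ t0) (is_derive_cst c _ _)) _.
    by rewrite subr0.
  apply: is_derive_eq (is_deriveM da df) _.
  by rewrite /GRing.scale/=; ring.
(* The half-line starts at [T + 1] because the derivative of [H] is known only strictly after [T],
   while continuity is required at the closed end. *)
have cH : {within `[T + 1, +oo[, continuous H}.
  apply: derivable_within_continuous => x; rewrite in_itv/= andbT => Tx.
  by have [] := dH x ltac:(lra).
have Hle t : T + 1 <= t -> H t <= H (T + 1).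
  move=> Tt.
  have dH1 s : T + 1 < s ->
      is_derive s (1 : R) H (expR (a * s) * (g s + a * f s - a * c)).
    by move=> Ts; apply: dH; lra.
  apply: (derivative_nonincreasing cH dH1 _ (lexx _) Tt) => s Ts.
  rewrite pmulr_rle0 ?expR_gt0//.
  have -> : a * c = b + a * (e / 2) by rewrite /c; field; rewrite gt_eqF.
  have : T < s by lra.
  rewrite gt_max => /andP[/gT/=]; rewrite ltr_norml => /andP[? ?] _; lra.
near=> t.
have Tt : T + 1 <= t by near: t; apply: nbhs_pinfty_ge; exact: num_real.
have := Hle _ Tt; rewrite /H.
(* Since [expR (a * t) >= 1 + a * t], this threshold makes [expR (a * t) * (e / 2)] exceed the
   constant [H (T + 1)]. *)
have : 2 * `|H (T + 1)| / (e * a) < t.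
  by near: t; apply: nbhs_pinfty_gt; exact: num_real.
rewrite ltr_pdivrMr ?mulr_gt0// => He.
have Ex := expR_ge1Dx (a * t).
have : H (T + 1) < expR (a * t) * (e / 2).
  apply: le_lt_trans (ler_norm _) _.
  rewrite (@lt_le_trans _ _ ((1 + a * t) * (e / 2)))//; last first.
    by rewrite ler_wpM2r// ltW// divr_gt0.
  nra.
move=> h1 /le_lt_trans /(_ h1); rewrite ltr_pM2l ?expR_gt0// /c; lra.
Unshelve. all: by end_near. Qed.

Lemma linear_ode_cvg f g (a b : R) : 0 < a ->
  (forall t, 0 < t -> is_derive t (1 : R) f (g t)) ->
  (g t + a * f t) @[t --> +oo] --> b -> f t @[t --> +oo] --> b / a.
Proof.
move=> a0 dfg gfb; apply/cvgrPdist_lt => e e0; near=> t.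
rewrite ltr_norml; apply/andP; split.
  suff : f t < b / a + e by lra.
  by near: t; exact: linear_ode_lt dfg gfb.
suff : - f t < - b / a + e by lra.
near: t; apply: (@linear_ode_lt (fun t => - f t) (fun t => - g t)) => //.
  by move=> t /dfg df; exact: is_deriveN.
by under eq_fun do rewrite mulrN -opprD; exact: cvgN.
Unshelve. all: by end_near. Qed.

Lemma nonincreasing_cvg f (m : R) :
  (forall s t, 0 <= s -> s <= t -> f t <= f s) ->
  (forall t, 0 <= t -> m <= f t) -> exists l, f t @[t --> +oo] --> l.
Proof.
(* Freezing [f] at its initial value before time 0 yields a function that is monotone on the whole
   line. *)
move=> fdec fm; pose h t := - f (Num.max t 0).
have hnd : nondecreasing_fun h.
  move=> s t st; rewrite lerN2; apply: fdec; first by rewrite le_max lexx orbT.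
  by rewrite ge_max !le_max st lexx orbT.
have hub : has_ubound (range h).
  by exists (- m) => _ [t _ <-]; rewrite lerN2 fm// le_max lexx orbT.
exists (- sup (range h)).
have hl : - h t @[t --> +oo] --> - sup (range h).
  exact: cvgN (nondecreasing_cvgr hnd hub).
apply: cvg_trans hl; apply: near_eq_cvg; near=> t.
have t0 : 0 <= t by near: t; exact: nbhs_pinfty_ge.
by rewrite /h opprK max_l.
Unshelve. all: by end_near. Qed.

(** A continuity argument: the largest ratio of [h i t] to [d i] starts below 1, and to exceed 1 it
    would have to equal 1 at some time. At that time all the weak bounds hold, and the hypothesis
    upgrades them to strict ones, a contradiction. *)
Lemma trapped (I : finType) (h : I -> R -> R) (d : I -> R) :
  (forall i, {within `[0, +oo[, continuous (h i)}) ->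
  (forall i, `|h i 0| < d i) ->
  (forall t, 0 <= t -> (forall i, `|h i t| <= d i) -> forall i, `|h i t| < d i) ->
  forall t, 0 <= t -> forall i, `|h i t| < d i.
Proof.
move=> ch h0 htrap.
have d0 i : 0 < d i by exact: le_lt_trans (h0 i).
(* The ratios are nonnegative, so starting the maximum at 0 changes nothing and gives a value below
   1 when [I] is empty. *)
pose f t := \big[Num.max/0]_(i : I) (`|h i t| / d i).
have fle t (c : R) : (f t < c) = (0 < c) && [forall i, `|h i t| / d i < c].
  apply/idP/idP => [ftc|/andP[c0 /forallP hc]]; last exact: bigmax_lt.
  rewrite (le_lt_trans _ ftc) ?bigmax_ge_id//; apply/forallP => i.
  by rewrite (le_lt_trans _ ftc)// le_bigmax.
have cf : {within `[0, +oo[, continuous f}.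
  apply: continuous_big => [|i _]; first exact: max_continuous.
  move=> x; apply: cvgM; last exact: cvg_cst.
  by apply: cvg_norm; exact: ch.
have f01 : f 0 < 1.
  by rewrite fle ltr01; apply/forallP => i; rewrite ltr_pdivrMr ?mul1r.
move=> t t0; suff : f t < 1.
  by rewrite fle ltr01 => /forallP + i => /(_ i); rewrite ltr_pdivrMr ?mul1r.
rewrite ltNge; apply/negP => ft1.
have [|||c] := @IVT _ f 0 t 1 => //.
- by apply: continuous_subspaceW cf; exact: subset_itvl.
- by rewrite ge_min le_max (ltW f01) ft1 orbT.
rewrite in_itv/= => /andP[c0 _] fc1.
have /htrap-/(_ c0) : forall i, `|h i c| <= d i.
  move=> i; rewrite -[d i]mul1r -ler_pdivrMr// -fc1.
  exact: le_bigmax.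
move=> hc; suff : f c < 1 by rewrite fc1 ltxx.
by rewrite fle ltr01; apply/forallP => i; rewrite ltr_pdivrMr ?mul1r.
Qed.

Lemma cvgr_sum (I T : Type) (r : seq I) (Q : pred I) (G : set_system T)
    (F : I -> T -> R) (L : I -> R) : Filter G ->
  (forall i, F i x @[x --> G] --> L i) ->
  \sum_(i <- r | Q i) F i x @[x --> G] --> \sum_(i <- r | Q i) L i.
Proof.
by move=> FG FL; apply: cvg_big => //; exact: add_continuous.
Qed.

(** * Limits at infinity *)

Local Notation lim_pinfty f l := ((f : R -> R) t @[t --> +oo] --> (l : R)).

Lemma lim_cst c : lim_pinfty (fun=> c) c.
Proof. exact: cvg_cst. Qed.

Lemma limD f g a b : lim_pinfty f a -> lim_pinfty g b ->
  lim_pinfty (fun t => f t + g t) (a + b).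
Proof. exact: cvgD. Qed.

Lemma limN f a : lim_pinfty f a -> lim_pinfty (fun t => - f t) (- a).
Proof. exact: cvgN. Qed.

Lemma limM f g a b : lim_pinfty f a -> lim_pinfty g b ->
  lim_pinfty (fun t => f t * g t) (a * b).
Proof. exact: cvgM. Qed.

Lemma lim_sum (I : finType) (F : I -> R -> R) (L : I -> R) :
  (forall i, lim_pinfty (F i) (L i)) ->
  lim_pinfty (fun t => \sum_i F i t) (\sum_i L i).
Proof. by move=> FL; exact: cvgr_sum. Qed.

Lemma lim_scale c f a : lim_pinfty f a -> lim_pinfty (fun t => c * f t) (c * a).
Proof. by move=> fa; exact: (limM (@lim_cst c) fa). Qed.

Lemma eq_lim f g a b : (forall t, 0 < t -> f t = g t) -> a = b ->
  lim_pinfty f a -> lim_pinfty g b.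
Proof.
move=> fg -> fb; apply: cvg_trans fb; apply: near_eq_cvg; near=> t.
by rewrite fg//; near: t; exact: nbhs_pinfty_gt.
Unshelve. all: by end_near. Qed.

Lemma open_sublevel (T : topologicalType) (f : T -> R) c :
  continuous f -> open [set u | f u < c].
Proof.
move=> cf; apply: (@open_comp _ _ f [set x | x < c]); last exact: open_lt.
by move=> u _; exact: cf.
Qed.

Lemma open_forall_dist_lt (T : topologicalType) (I : finType)
    (f : T -> I -> R) (a r : I -> R) :
  (forall i, continuous (fun u => f u i)) ->
  open [set u | forall i, `|f u i - a i| < r i].
Proof.
move=> cf; rewrite openE => u ur; apply: filter_forall => i.
have cn : continuous (fun u => `|f u i - a i|).
  have ca : continuous (fun _ : T => a i) by exact: cst_continuous.
  by move=> v; apply: cvg_norm; exact: (continuousB (cf i v) (ca v)).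
have : open [set u | `|f u i - a i| < r i] by exact: open_sublevel cn.
by rewrite openE => /(_ u); apply; exact: ur.
Qed.

End RealAnalysis.

(** * Linear algebra and sums over graphs *)

Section Algebra.
Variable R : realType.

(** A kernel vector of a singular [A] would be an eigenvector for 0, whose real part is not
    negative. *)
Lemma hurwitz_unitmx n (A : 'M[R]_n) : hurwitz A -> A \in unitmx.
Proof.
move=> hA; rewrite unitmxE unitfE; apply/negP => /det0P[v v0 vA0].
suff /hA : eigenvalue (map_mx (real_complex R) A) 0 by rewrite ltxx.
apply/eigenvalueP; exists (map_mx (real_complex R) v).
  by rewrite -map_mxM vA0 scale0r; apply/matrixP => i j; rewrite !mxE.
by rewrite map_mx_eq0.
Qed.

Lemma posdef_unitmx n (P : 'M[R]_n) : posdef P -> P \in unitmx.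
Proof.
move=> [Psym Ppos]; rewrite unitmxE unitfE; apply/negP => /det0P[v v0 vP0].
have := Ppos v^T; rewrite trmxK vP0 mul0mx mxE ltxx => /(_ _)/notF; apply.
by apply: contra v0 => /eqP /(congr1 trmx); rewrite trmxK trmx0 => ->.
Qed.

Lemma posdef_ge0 n (P : 'M[R]_n) (v : 'cV[R]_n) : posdef P ->
  0 <= (v^T *m P *m v) 0 0.
Proof.
move=> [_ Ppos]; have [->|/Ppos/ltW//] := eqVneq v 0.
by rewrite mulmx0 mxE.
Qed.

(* Cauchy-Schwarz for the inner product [P], applied to [v] and
   [P^-1 e_i]. *)
Lemma posdef_coord n (P : 'M[R]_n) (i : 'I_n) : posdef P ->
  exists2 c : R, 0 < c &
    forall v : 'cV[R]_n, v i 0 ^+ 2 <= c * (v^T *m P *m v) 0 0.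
Proof.
move=> Ppd; have Pu := posdef_unitmx Ppd; have [Psym Ppos] := Ppd.
pose e : 'cV[R]_n := delta_mx i 0; pose w := invmx P *m e.
have Pw : P *m w = e by rewrite mulKVmx.
have w0 : w != 0.
  apply/eqP => w0; move: Pw; rewrite w0 mulmx0 => /matrixP/(_ i 0).
  by rewrite !mxE !eqxx => /eqP; rewrite eq_sym oner_eq0.
exists ((w^T *m P *m w) 0 0) => [|v]; first exact: Ppos.
set q := (w^T *m P *m w) 0 0; have q0 : 0 < q by exact: Ppos.
have vPw : (v^T *m P *m w) 0 0 = v i 0.
  by rewrite -mulmxA Pw -colE !mxE.
have wPv : (w^T *m P *m v) 0 0 = v i 0.
  rewrite -vPw -[v in LHS]trmxK -[P in LHS]Psym -mulmxA -!trmx_mul mxE.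
  by rewrite mulmxA.
(* This [t] minimizes the form at [v - t *: w], where its value is the form at [v] minus
   [v i 0 ^+ 2 / q]. *)
pose t := v i 0 / q.
have := posdef_ge0 (v - t *: w) Ppd.
have -> : (v - t *: w)^T = v^T - t *: w^T by apply/matrixP => a b; rewrite !mxE.
rewrite !mulmxBl !mulmxBr -!scalemxAl -!scalemxAr.
set X := v^T *m P *m v; set Y := v^T *m P *m w; set Z := w^T *m P *m v.
set Q := w^T *m P *m w.
have -> : (X - t *: Y - (t *: Z - t *: (t *: Q))) 0 0 =
    X 0 0 - t * Y 0 0 - (t * Z 0 0 - t * (t * Q 0 0)) by rewrite !mxE.
rewrite -/Q -/q vPw wPv => h.
have tq : t * q = v i 0 by rewrite /t divfK ?gt_eqF.
nra.
Qed.

(** Summation by parts on a directed graph: each edge contributes once at its source and once at its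
    target. With [x] constant the flows cancel in total. *)
Lemma sum_weighted_net (E N : finType) (src dst : E -> N) (phi : E -> R)
    (x : N -> R) :
  \sum_j x j * (- \sum_(e | src e == j) phi e + \sum_(e | dst e == j) phi e) =
  - \sum_e phi e * (x (src e) - x (dst e)).
Proof.
have part (f : E -> N) :
    \sum_j x j * \sum_(e | f e == j) phi e = \sum_e phi e * x (f e).
  rewrite [RHS](partition_big f xpredT)//=; apply: eq_bigr => j _.
  by rewrite big_distrr/=; apply: eq_bigr => e /eqP ->; rewrite mulrC.
under eq_bigr do rewrite mulrDr mulrN.
rewrite big_split/= sumrN !part -sumrN -sumrN -big_split/=.
by apply: eq_bigr => e _; ring.
Qed.

Section Laplacian.
Variables (I : finType) (r : rel I) (a : I -> I -> R).
Hypotheses (r_sym : symmetric r) (a_sym : forall i j, r i j -> a i j = a j i).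

(** The double sum is averaged with the one obtained by exchanging [i] and [j], which is the same by
    symmetry of the weights; hence the factor [2^-1]. *)
Lemma sum_weighted_laplacian (x p : I -> R) :
  \sum_j x j * (\sum_(i | r j i) a i j * (p i - p j)) =
  - (2^-1 * \sum_j \sum_(i | r j i) a i j * ((x i - x j) * (p i - p j))).
Proof.
pose S := \sum_j x j * (\sum_(i | r j i) a i j * (p i - p j)).
have S1 : S = \sum_j \sum_(i | r j i) a i j * (x j * (p i - p j)).
  apply: eq_bigr => j _; rewrite big_distrr/=; apply: eq_bigr => i _; ring.
have S2 : S = \sum_j \sum_(i | r j i) a i j * (x i * (p j - p i)).
  rewrite S1; under eq_bigr do rewrite big_mkcond.
  rewrite exchange_big/=; apply: eq_bigr => i _.
  rewrite [RHS]big_mkcond/=; apply: eq_bigr => j _; rewrite r_sym.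
  by case: ifP => // /a_sym ->.
have : S + S = - \sum_j \sum_(i | r j i) a i j * ((x i - x j) * (p i - p j)).
  rewrite [X in X + _]S1 [X in _ + X]S2 -sumrN -big_split/=.
  apply: eq_bigr => j _; rewrite -sumrN -big_split/=.
  by apply: eq_bigr => i _; ring.
rewrite -/S; lra.
Qed.

Lemma sum_laplacian (p : I -> R) :
  \sum_j \sum_(i | r j i) a i j * (p i - p j) = 0.
Proof.
have := sum_weighted_laplacian (fun=> 1) p.
under eq_bigr do rewrite mul1r; move=> ->.
rewrite big1 ?mulr0 ?oppr0// => j _; rewrite big1// => i _.
by rewrite subrr mul0r mulr0.
Qed.

End Laplacian.

(** The expression is the increment from [a] to [y] of a function with derivative [sin x - sin a].
    The hypothesis keeps [a] and [y] in the interval where [sin] is strictly increasing, so the mean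
    value theorem gives the sign. *)
Lemma cos_well_gt0 (a y : R) : `|a| + `|y - a| <= pi / 2 -> y != a ->
  0 < cos a - cos y - (y - a) * sin a.
Proof.
move=> ay ya.
pose G (x : R) := - cos x - x * sin a.
have dG (x : R) : is_derive x (1 : R) G (sin x - sin a).
  have dx : is_derive x (1 : R) (fun s : R => s * sin a) _ :=
    is_deriveM (is_derive_id x _) (is_derive_cst (sin a) x _).
  apply: is_derive_eq (is_deriveB (is_deriveN (is_derive_cos x)) dx) _.
  by rewrite /GRing.scale/= opprK mulr0 add0r mulr1.
have cG (u v : R) : {within `[u, v], continuous G}.
  by apply: derivable_within_continuous => x _; have [] := dG x.
have -> : cos a - cos y - (y - a) * sin a = G y - G a by rewrite /G; ring.
have aI : a \in `[- (pi / 2), pi / 2]%R.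
  rewrite in_itv/= -ler_norml; apply: le_trans ay; by rewrite lerDl.
have yI : y \in `[- (pi / 2), pi / 2]%R.
  rewrite in_itv/= -ler_norml; apply: le_trans ay.
  by rewrite addrC -[in leLHS](subrK a y) ler_normD.
have bI (u v x : R) : u \in `[- (pi / 2), pi / 2]%R ->
    v \in `[- (pi / 2), pi / 2]%R -> x \in `]u, v[%R ->
    x \in `[- (pi / 2), pi / 2]%R.
  rewrite !in_itv/= => /andP[? _] /andP[_ ?] /andP[? ?].
  by apply/andP; split; lra.
move: ya; rewrite neq_lt => /orP[ya|ay'].
- have [c cI Gc] := MVT ya (fun x _ => dG x) (cG y a).
  have cs : sin c < sin a.
    by rewrite ltr_sin// ?(bI _ _ _ yI aI cI)//; move: cI; rewrite in_itv/= => /andP[].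
  by rewrite -opprB Gc oppr_gt0 nmulr_rlt0 ?subr_lt0// subr_gt0.
- have [c cI Gc] := MVT ay' (fun x _ => dG x) (cG a y).
  have cs : sin a < sin c.
    by rewrite ltr_sin// ?(bI _ _ _ aI yI cI)//; move: cI; rewrite in_itv/= => /andP[].
  by rewrite Gc mulr_gt0// subr_gt0.
Qed.

Lemma cos_well_ge0 (a y : R) : `|a| + `|y - a| <= pi / 2 ->
  0 <= cos a - cos y - (y - a) * sin a.
Proof.
move=> ay; have [->|ya] := eqVneq y a; first by rewrite !subrr mul0r subr0.
exact/ltW/cos_well_gt0.
Qed.

Lemma finite_lower_bound (I : finType) (f : I -> R) : (forall i, 0 < f i) ->
  exists2 m : R, 0 < m & forall i, m <= f i.
Proof.
move=> f0; exists (\big[Num.min/1]_i f i); last by move=> i; exact: bigmin_inf (lexx _).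
by apply: lt_bigmin.
Qed.

End Algebra.

(** * The quadratic form of the design matrix *)

Section DesignInequality.
Variables (R : realType) (g l : nat).
Variables (nw : network R g l) (gen : generation R g) (ctl : controller R g).
Variable j : 'I_g.
Local Notation A := (mxA gen j).
Local Notation B := (mxB gen j).
Local Notation C := (mxC gen j).
Local Notation D := (mxD gen j).
Local Notation K := (static_gain gen j).

(** Here [a], [x], [w], [u], [y] stand for deviations from the equilibrium at one bus. The left-hand
    side minus [hL * w ^+ 2] is exactly the value of the design form at one vector. *)
Lemma design_mx_form (P : 'M[R]_(dimx gen j)) (hL a w u y : R)
    (x : 'cV[R]_(dimx gen j)) :
  P^T = P -> negsemidef (design_mx ctl P hL) ->
  u = kc ctl j * a - kd ctl j * w ->
  y = (C *m x) 0 0 + D * u ->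
  (x^T *m P *m (A *m x + u *: B)) 0 0 + w * y
    + a * (y - K * u - kf ctl j * w) <= hL * w ^+ 2.
Proof.
(* The test vector is [(a, x, - w)]; the minus sign makes the cross terms agree with the feedback
   [- kd ctl j * w] in [u]. *)
move=> Psym [_ /(_ (col_mx a%:M (col_mx x (- w)%:M))) h] uE yE; move: h.
rewrite /design_mx /design_Q /design_r.
rewrite !tr_col_mx !tr_scalar_mx trmxK !mul_row_block !mul_row_col.
rewrite !mulmxDl tr_row_mx !mul_mx_scalar !mul_scalar_mx.
have EA : x^T *m P *m A *m x = ((x^T *m P *m A *m x) 0 0)%:M by exact: mx11_scalar.
have Eb : x^T *m P *m B = ((x^T *m P *m B) 0 0)%:M by exact: mx11_scalar.
have Ec : C *m x = ((C *m x) 0 0)%:M by exact: mx11_scalar.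
rewrite yE {y yE}.
move: EA Eb Ec.
set al := _ 0 0; set be := _ 0 0; set c := _ 0 0 => EA Eb Ec.
have EA' : x^T *m A^T *m P *m x = al%:M.
  by rewrite -[al%:M]tr_scalar_mx -EA !trmx_mul Psym trmxK !mulmxA.
have Eb' : B^T *m P *m x = be%:M.
  by rewrite -[be%:M]tr_scalar_mx -Eb !trmx_mul Psym trmxK !mulmxA.
have Ec' : x^T *m C^T = c%:M.
  by rewrite -[c%:M]tr_scalar_mx -Ec !trmx_mul.
have scal (M : 'M[R]_1) (z : R) : M 0 0 = z -> M = z%:M.
  by move=> <-; exact: mx11_scalar.
have E1 : 2^-1 *: (kc ctl j *: (B^T *m P) + C) *m x =
    (2^-1 * (kc ctl j * be + c))%:M.
  by apply: scal; rewrite -scalemxAl mulmxDl -scalemxAl Eb' Ec !mxE !mulr1n.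
have E2 : x^T *m (2^-1 *: (kc ctl j *: (B^T *m P) + C))^T =
    (2^-1 * (kc ctl j * be + c))%:M.
  by rewrite -trmx_mul E1 tr_scalar_mx.
have E3 : (x^T *m (2^-1 *: (P *m A + A^T *m P)) +
    - w *: (2^-1 *: (kd ctl j *: (B^T *m P) - C))) *m x =
    (al - w * (2^-1 * (kd ctl j * be - c)))%:M.
  apply: scal; rewrite mulmxDl -!scalemxAl mulmxBl -scalemxAl Eb' Ec -scalemxAr.
  rewrite -scalemxAl mulmxDr mulmxDl !mulmxA EA EA' !mxE !mulr1n; lra.
have E4 : x^T *m (2^-1 *: (kd ctl j *: (P *m B) - C^T)) =
    (2^-1 * (kd ctl j * be - c))%:M.
  by apply: scal; rewrite -scalemxAr mulmxBr -scalemxAr mulmxA Eb Ec' !mxE !mulr1n.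
have E5 : (x^T *m P *m (A *m x + u *: B)) 0 0 = al + u * be.
  by rewrite mulmxDr -scalemxAr mulmxA EA Eb !mxE !mulr1n.
rewrite mul_row_col -(scalemxAl a) !mul_row_col E1 E2 E3 E4 E5 tr_scalar_mx.
rewrite !mul_mx_scalar !mxE !mulr1n uE; lra.
Qed.

End DesignInequality.

(** * The energy function *)

Section Energy.
Variables (R : realType) (g l : nat).
Variables (nw : network R g l) (gen : generation R g) (ctl : controller R g).
Variables (b : configuration nw gen) (P : forall j, 'M[R]_(dimx gen j)).

Lemma le_sum_term (I : finType) (F : I -> R) (i : I) :
  (forall j, 0 <= F j) -> F i <= \sum_j F j.
Proof. by move=> F0; rewrite (bigD1 i)//= lerDl sumr_ge0. Qed.

Lemma continuous_at_sum (T : topologicalType) (I : finType) (F : I -> T -> R)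
    (s : T) : (forall i, {for s, continuous (F i)}) ->
  {for s, continuous (fun x => \sum_i F i x)}.
Proof. by move=> cF; exact: cvgr_sum. Qed.

(** The product rule gives two terms that are transposes of each other, as [Q] is symmetric; the
    factor [2^-1] merges them. *)
Lemma is_derive_quadform n (Q : 'M[R]_n) (X : R -> 'cV[R]_n) (c dX : 'cV[R]_n)
    (t : R) : Q^T = Q ->
  (forall i, is_derive t (1 : R) (fun s => X s i 0) (dX i 0)) ->
  is_derive t (1 : R) (fun s => 2^-1 * ((X s - c)^T *m Q *m (X s - c)) 0 0)
    (((X t - c)^T *m Q *m dX) 0 0).
Proof.
move=> Qsym dXi; pose Y s i := X s i 0 - c i 0.
have dY i : is_derive t (1 : R) (Y^~ i) (dX i 0).
  have := is_deriveB (dXi i) (is_derive_cst (c i 0) t (1 : R)).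
  by rewrite subr0.
have -> : (fun s => 2^-1 * ((X s - c)^T *m Q *m (X s - c)) 0 0) =
    (fun s => 2^-1 * \sum_k (\sum_i Y s i * Q i k) * Y s k).
  apply/funext => s; rewrite mxE; congr (_ * _); apply: eq_bigr => k _.
  rewrite !mxE; congr (_ * _); apply: eq_bigr => i _; by rewrite !mxE.
have dYQ k : is_derive t (1 : R) (fun s => \sum_i Y s i * Q i k)
    (\sum_i dX i 0 * Q i k).
  apply: is_derive_bigsum => i.
  apply: is_derive_eq (is_deriveM (dY i) (is_derive_cst (Q i k) t (1 : R))) _.
  by rewrite /GRing.scale/= mulr0 add0r mulrC.
have dS : is_derive t (1 : R) (fun s => \sum_k (\sum_i Y s i * Q i k) * Y s k)
    (\sum_k ((\sum_i Y t i * Q i k) * dX k 0 + Y t k * (\sum_i dX i 0 * Q i k))).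
  apply: is_derive_bigsum => k; exact: (is_deriveM (dYQ k) (dY k)).
apply: is_derive_eq (is_deriveZ 2^-1 dS) _.
rewrite big_split/=.
have -> : \sum_k (\sum_i Y t i * Q i k) * dX k 0 = ((X t - c)^T *m Q *m dX) 0 0.
  rewrite mxE; apply: eq_bigr => k _.
  by rewrite mxE; congr (_ * _); apply: eq_bigr => i _; rewrite !mxE.
have -> : \sum_k Y t k * (\sum_i dX i 0 * Q i k) = (dX^T *m Q *m (X t - c)) 0 0.
  rewrite mxE; apply: eq_bigr => k _.
  by rewrite mulrC !mxE; congr (_ * _); apply: eq_bigr => i _; rewrite !mxE.
have -> : dX^T *m Q *m (X t - c) = ((X t - c)^T *m Q *m dX)^T.
  by rewrite !trmx_mul Qsym trmxK mulmxA.
by rewrite [X in _ + X]mxE /GRing.scale/=; lra.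
Qed.

(* The summand of a line is the integral of [sin - sin (angle b e)] from the
   equilibrium angle to [a e]. *)
Definition energy (a : line nw -> R) (w : 'I_g -> R)
    (x : forall j, 'cV[R]_(dimx gen j)) (p : 'I_g -> R) : R :=
  \sum_e suscept nw (val e).1 (val e).2 *
    (cos (angle b e) - cos (a e) - (a e - angle b e) * sin (angle b e))
  + \sum_j 2^-1 * inertia nw j * (w j - freq b (lshift l j)) ^+ 2
  + \sum_j 2^-1 * ((x j - xM b j)^T *m P j *m (x j - xM b j)) 0 0
  + \sum_j 2^-1 * gam ctl j * (p j - pc b j) ^+ 2.

(** The space [T] is abstract because two instances are used: the state space, to get an open
    sublevel set, and the half-line of times, to follow a solution. *)
Lemma continuous_energy (T : topologicalType) (a : T -> line nw -> R)
    (w : T -> 'I_g -> R) (x : T -> forall j, 'cV[R]_(dimx gen j))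
    (p : T -> 'I_g -> R) :
  (forall e, continuous (fun s => a s e)) ->
  (forall j, continuous (fun s => w s j)) ->
  (forall j i, continuous (fun s => x s j i 0)) ->
  (forall j, continuous (fun s => p s j)) ->
  continuous (fun s => energy (a s) (w s) (x s) (p s)).
Proof.
move=> ca cw cx cp.
pose F1 (e : line nw) (s : T) := suscept nw (val e).1 (val e).2 *
  (cos (angle b e) - cos (a s e) - (a s e - angle b e) * sin (angle b e)).
pose F2 j (s : T) := 2^-1 * inertia nw j * (w s j - freq b (lshift l j)) ^+ 2.
pose F3 j (s : T) :=
  2^-1 * ((x s j - xM b j)^T *m P j *m (x s j - xM b j)) 0 0.
pose F4 j (s : T) := 2^-1 * gam ctl j * (p s j - pc b j) ^+ 2.
have cc (c : R) : continuous (fun _ : T => c) by exact: cst_continuous.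
have c1 (e : line nw) : continuous (F1 e).
  move=> s; have cb := continuous_comp (ca e s) (@continuous_cos R _).
  have cd := continuousM (continuousB (ca e s) (cc (angle b e) s))
    (cc (sin (angle b e)) s).
  have ce := continuousB (continuousB (cc (cos (angle b e)) s) cb) cd.
  exact: (continuousM (cc (suscept nw (val e).1 (val e).2) s) ce).
have c2 j : continuous (F2 j).
  move=> s; have cj := continuousB (cw j s) (cc (freq b (lshift l j)) s).
  exact: (continuousM (cc (2^-1 * inertia nw j) s) (continuousM cj cj)).
have c4 j : continuous (F4 j).
  move=> s; have cj := continuousB (cp j s) (cc (pc b j) s).
  exact: (continuousM (cc (2^-1 * gam ctl j) s) (continuousM cj cj)).
have c3 j : continuous (F3 j).
  have -> : F3 j = fun s => 2^-1 * \sum_k (\sum_i (x s j i 0 - xM b j i 0) *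
      P j i k) * (x s j k 0 - xM b j k 0).
    apply/funext => s; rewrite /F3 mxE; congr (_ * _); apply: eq_bigr => k _.
    by rewrite !mxE; congr (_ * _); apply: eq_bigr => i _; rewrite !mxE.
  move=> s.
  have cd k := continuousB (cx j k s) (cc (xM b j k 0) s).
  have ce k := continuous_at_sum
    (fun i => continuousM (cd i) (cc (P j i k) s)).
  have cf := continuous_at_sum
    (fun k => continuousM (ce k) (cd k)).
  exact: (continuousM (cc 2^-1 s) cf).
move=> s.
have s1 := continuous_at_sum (fun e => c1 e s).
have s2 := continuous_at_sum (fun j => c2 j s).
have s3 := continuous_at_sum (fun j => c3 j s).
have s4 := continuous_at_sum (fun j => c4 j s).
exact: (continuousD (continuousD (continuousD s1 s2) s3) s4).
Qed.

Lemma state_coordinates_continuous :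
  [/\ forall e, continuous (fun s : state nw gen => s.1.1.1 e),
      forall j, continuous (fun s : state nw gen => s.1.1.2 j),
      forall j i, continuous (fun s : state nw gen => s.1.2 j i 0)
    & forall j, continuous (fun s : state nw gen => s.2 j)].
Proof.
split=> [e|j|j i|j] s.
- apply: (@cvg_comp _ _ _ (fun s : state nw gen => s.1.1.1) (fun f => f e)).
    exact: (cvg_comp _ _ (cvg_comp _ _ cvg_fst cvg_fst) cvg_fst).
  exact: (@proj_continuous _ (fun _ : line nw => R : topologicalType) e).
- apply: (@cvg_comp _ _ _ (fun s : state nw gen => s.1.1.2) (fun f => f j)).
    exact: (cvg_comp _ _ (cvg_comp _ _ cvg_fst cvg_fst) cvg_snd).
  exact: (@proj_continuous _ (fun _ : 'I_g => R : topologicalType) j).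
- apply: (@cvg_comp _ _ _ (fun s : state nw gen => s.1.2)
      (fun f : forall j, 'cV[R]_(dimx gen j) => f j i 0)).
    exact: (cvg_comp _ _ cvg_fst cvg_snd).
  apply: (@cvg_comp _ _ _ (fun f : forall j, 'cV[R]_(dimx gen j) => f j)
      (fun x => x i 0)); last exact: coord_continuous.
  exact: (@proj_continuous _
    (fun j : 'I_g => 'cV[R]_(dimx gen j) : topologicalType) j).
- apply: (@cvg_comp _ _ _ (fun s : state nw gen => s.2) (fun f => f j)).
    exact: cvg_snd.
  exact: (@proj_continuous _ (fun _ : 'I_g => R : topologicalType) j).
Qed.

End Energy.

Lemma connect_eq (T : finType) (U : Type) (e : rel T) (f : T -> U) :
  (forall x y, e x y -> f x = f y) -> forall x y, connect e x y -> f x = f y.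
Proof.
move=> ef x y /connectP[p + ->]; elim: p x => //= z p IH x /andP[/ef -> /IH].
by [].
Qed.

(** * Equilibria and the dissipation inequality *)

Section Dissipation.
Variables (R : realType) (g l : nat).
Variables (nw : network R g l) (gen : generation R g) (ctl : controller R g).
Implicit Types b c : configuration nw gen.

Lemma equilibrium_freq_eq b i j : equilibrium ctl b -> freq b i = freq b j.
Proof.
move=> [_ [b_angle _ _ _]].
apply: connect_eq (lines_connected nw i j) => x y.
wlog xy : x y / (x, y) \in lines nw.
  by move=> h /orP[xy|yx]; [|symmetry]; apply: h; rewrite ?xy ?yx.
move=> _; apply/eqP; rewrite -subr_eq0; apply/eqP.
by rewrite (b_angle (exist _ (x, y) xy)).
Qed.

(** A Hurwitz [mxA] is invertible, so the stationary generator state is determined by the input, and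
    substituting it produces the static gain. *)
Lemma equilibrium_pM b j : equilibrium ctl b ->
  pM ctl b j = static_gain gen j * input ctl b j.
Proof.
move=> [_ [_ _ /(_ j) bx _]]; have Au := hurwitz_unitmx (@mxA_hurwitz _ _ gen j).
have -> : pM ctl b j =
  (mxC gen j *m xM b j) 0 0 + mxD gen j * input ctl b j by [].
have -> : xM b j = - input ctl b j *: (invmx (mxA gen j) *m mxB gen j).
  have /eqP : mxA gen j *m xM b j + input ctl b j *: mxB gen j = 0 by rewrite -bx.
  rewrite addr_eq0 => /eqP Ax.
  by rewrite -[LHS](mulKmx Au) Ax mulmxN -scalemxAr scaleNr.
by rewrite -scalemxAr mulmxA mxE /static_gain; ring.
Qed.

(** In the sum of the controller equations the communication terms cancel, and [pM] cancels against
    the static gain. What remains is the common frequency times the positive sum of the [kf]. *)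
Lemma equilibrium_freq0 b n : (0 < g)%N -> equilibrium ctl b -> freq b n = 0.
Proof.
move=> g0 beq; have [_ [_ _ _ bp]] := beq.
have : \sum_j (kf ctl j * freq b n) = 0.
  rewrite -[RHS](sum_laplacian (comm_sym ctl) (@alpha_sym _ _ ctl) (pc b)).
  apply: eq_bigr => j _; have := bp j; rewrite mulr0 equilibrium_pM// subrr.
  by rewrite sub0r (@equilibrium_freq_eq b (lshift l j) n)// => h; lra.
rewrite -mulr_suml => /eqP; rewrite mulf_eq0 => /orP[|/eqP//].
rewrite psumr_eq0 => [/allP/(_ (Ordinal g0))|j _]; last exact/ltW/kf_gt0.
rewrite mem_index_enum => /(_ isT) /= /eqP h.
by have := kf_gt0 ctl (Ordinal g0); rewrite h ltxx.
Qed.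

Lemma sum_net_flow c (x : 'I_(g + l) -> R) :
  \sum_n x n * net_flow c n =
  - \sum_e flow c e * (x (val e).1 - x (val e).2).
Proof. exact: sum_weighted_net. Qed.

(** The left-hand side is the derivative of the energy, written for arbitrary values satisfying the
    equations, which makes the claim purely algebraic. Power exchanged between lines and buses
    cancels, and each generator bus is handled by its design inequality. *)
Lemma dissipation b c da dw dx dp (P : forall j, 'M[R]_(dimx gen j))
    (hL : 'I_g -> R) :
  let W n := freq c n - freq b n in
  let p j := pc c j - pc b j in
  equilibrium ctl b -> algebraic_eqs c -> differential_eqs ctl c da dw dx dp ->
  (forall j, (P j)^T = P j) ->
  (forall j, negsemidef (design_mx ctl (P j) (hL j))) ->
  \sum_e (flow c e - flow b e) * da e
  + \sum_j inertia nw j * W (lshift l j) * dw j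
  + \sum_j ((xM c j - xM b j)^T *m P j *m dx j) 0 0
  + \sum_j gam ctl j * p j * dp j
  <= - (\sum_j (damping nw (lshift l j) - hL j) * W (lshift l j) ^+ 2
        + \sum_k damping nw (rshift g k) * W (rshift g k) ^+ 2
        + 2^-1 * \sum_j \sum_(i | comm ctl j i)
                   alpha ctl i j * (p i - p j) ^+ 2).
Proof.
move=> W p beq calg [ca cw cx cp] Psym design.
have [balg [_ bw bx bp]] := beq.
pose nf n := net_flow c n - net_flow b n.
pose u j := input ctl c j - input ctl b j.
pose y j := pM ctl c j - pM ctl b j.
have uE j : u j = kc ctl j * p j - kd ctl j * W (lshift l j).
  by rewrite /u /input /p /W; ring.
have yE j : y j = (mxC gen j *m (xM c j - xM b j)) 0 0 + mxD gen j * u j.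
  by rewrite /y /pM /u mulmxBr !mxE; ring.
(* The equilibrium frequencies are all equal, so [da e] is also a difference of deviations [W], and
   the line terms become minus the power received by the buses. *)
have sumE : \sum_e (flow c e - flow b e) * da e = - \sum_n W n * nf n.
  under [in RHS]eq_bigr do rewrite mulrBr.
  rewrite sumrB !sum_net_flow opprB opprK addrC -sumrB; apply: eq_bigr => e _.
  rewrite ca /W (@equilibrium_freq_eq b (val e).1 (val e).2)//; ring.
have sumL : \sum_k W (rshift g k) * nf (rshift g k) =
    \sum_k damping nw (rshift g k) * W (rshift g k) ^+ 2.
  apply: eq_bigr => k _; have := calg k; have := balg k; rewrite /= /nf /W => h1 h2.
  have -> : net_flow c (rshift g k) - net_flow b (rshift g k) =
    damping nw (rshift g k) * (freq c (rshift g k) - freq b (rshift g k)) by lra.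
  ring.
have sumG : \sum_j inertia nw j * W (lshift l j) * dw j =
    \sum_j W (lshift l j) * (y j - damping nw (lshift l j) * W (lshift l j))
    + \sum_j W (lshift l j) * nf (lshift l j).
  rewrite -big_split/=; apply: eq_bigr => j _.
  rewrite mulrAC cw -mulrDr mulrC; congr (_ * _).
  have := bw j; rewrite mulr0 /= /y /nf /W => h; lra.
have sumX : \sum_j ((xM c j - xM b j)^T *m P j *m dx j) 0 0 =
    \sum_j ((xM c j - xM b j)^T *m P j *m
       (mxA gen j *m (xM c j - xM b j) + u j *: mxB gen j)) 0 0.
  apply: eq_bigr => j _; congr ((_ *m _) 0 0).
  by rewrite mulmxBr scalerBl addrACA -opprD -bx subr0 cx.
have sumP : \sum_j gam ctl j * p j * dp j =
    \sum_j p j * (y j - static_gain gen j * u j - kf ctl j * W (lshift l j))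
    - 2^-1 * \sum_j \sum_(i | comm ctl j i) alpha ctl i j * (p i - p j) ^+ 2.
  have lap : \sum_j p j * (\sum_(i | comm ctl j i) alpha ctl i j * (p i - p j)) =
      - (2^-1 * \sum_j \sum_(i | comm ctl j i) alpha ctl i j * (p i - p j) ^+ 2).
    exact: (sum_weighted_laplacian (comm_sym ctl) (@alpha_sym _ _ ctl) p p).
  rewrite -lap.
  rewrite -big_split/=; apply: eq_bigr => j _.
  rewrite mulrAC cp -mulrDr mulrC; congr (_ * _).
  have -> : \sum_(i | comm ctl j i) alpha ctl i j * (p i - p j) =
      \sum_(i | comm ctl j i) alpha ctl i j * (pc c i - pc c j)
      - \sum_(i | comm ctl j i) alpha ctl i j * (pc b i - pc b j).
    by rewrite -sumrB; apply: eq_bigr => i _; rewrite /p; ring.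
  have := bp j; rewrite mulr0 /y /u /W => h; lra.
rewrite sumE big_split_ord/= sumL sumG sumX sumP.
(* Bus by bus, the design form yields [hL j] times the squared deviation, and the true damping is
   subtracted from it. *)
have key : \sum_j ((xM c j - xM b j)^T *m P j *m
       (mxA gen j *m (xM c j - xM b j) + u j *: mxB gen j)) 0 0
    + \sum_j W (lshift l j) * (y j - damping nw (lshift l j) * W (lshift l j))
    + \sum_j p j * (y j - static_gain gen j * u j - kf ctl j * W (lshift l j))
    <= - \sum_j (damping nw (lshift l j) - hL j) * W (lshift l j) ^+ 2.
  rewrite -!big_split -sumrN; apply: ler_sum => j _ /=.
  have := design_mx_form (Psym j) (design j) (uE j) (yE j); lra.
lra.
Qed.

End Dissipation.

(** * The potential well around the equilibrium *)

Section EnergyWell.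
Variables (R : realType) (g l : nat).
Variables (nw : network R g l) (gen : generation R g) (ctl : controller R g).
Variables (b : configuration nw gen) (P : forall j, 'M[R]_(dimx gen j)).
Hypothesis b_angle : forall e, `|angle b e| < pi / 2.
Hypothesis P_posdef : forall j, posdef (P j).

(** The largest deviation of the angle that [cos_well_gt0] admits. *)
Definition well_radius (e : line nw) : R := pi / 2 - `|angle b e|.

Lemma line_suscept_gt0 (e : line nw) : 0 < suscept nw (val e).1 (val e).2.
Proof. by case: e => [[i j] ij]; exact: suscept_gt0. Qed.

Lemma energy_eq0 :
  energy ctl b P (angle b) (fun j => freq b (lshift l j)) (xM b) (pc b) = 0.
Proof.
rewrite /energy big1 => [|e _]; last by rewrite !subrr mul0r subr0 mulr0.
rewrite big1 => [|j _]; last by rewrite subrr expr0n/= mulr0.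
rewrite big1 => [|j _]; last by rewrite subrr mulmx0 mxE mulr0.
by rewrite big1 => [|j _]; rewrite ?addr0// subrr expr0n/= mulr0.
Qed.

(** Inside the well every summand of the energy is nonnegative, so each one is bounded by the
    total. *)
Lemma energy_bounds (a : line nw -> R) (w : 'I_g -> R)
    (x : forall j, 'cV[R]_(dimx gen j)) (p : 'I_g -> R) :
  (forall e, `|a e - angle b e| <= well_radius e) ->
  let E := energy ctl b P a w x p in
  [/\ forall e, suscept nw (val e).1 (val e).2 *
        (cos (angle b e) - cos (a e) - (a e - angle b e) * sin (angle b e)) <= E,
      forall j, 2^-1 * inertia nw j * (w j - freq b (lshift l j)) ^+ 2 <= E,
      forall j, 2^-1 * ((x j - xM b j)^T *m P j *m (x j - xM b j)) 0 0 <= E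
    & forall j, 2^-1 * gam ctl j * (p j - pc b j) ^+ 2 <= E].
Proof.
move=> aR.
set F1 := fun e : line nw => suscept nw (val e).1 (val e).2 *
        (cos (angle b e) - cos (a e) - (a e - angle b e) * sin (angle b e)).
set F2 := fun j => 2^-1 * inertia nw j * (w j - freq b (lshift l j)) ^+ 2.
set F3 := fun j => 2^-1 * ((x j - xM b j)^T *m P j *m (x j - xM b j)) 0 0.
set F4 := fun j => 2^-1 * gam ctl j * (p j - pc b j) ^+ 2.
have F10 e : 0 <= F1 e.
  rewrite mulr_ge0 ?(ltW (line_suscept_gt0 _))// cos_well_ge0//.
  by have := aR e; rewrite /well_radius; lra.
have F20 j : 0 <= F2 j.
  by rewrite mulr_ge0 ?sqr_ge0// mulr_ge0 ?invr_ge0 ?ltW ?inertia_gt0.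
have F30 j : 0 <= F3 j by rewrite mulr_ge0 ?invr_ge0// posdef_ge0.
have F40 j : 0 <= F4 j.
  by rewrite mulr_ge0 ?sqr_ge0// mulr_ge0 ?invr_ge0 ?ltW ?gam_gt0.
have S1 : 0 <= \sum_e F1 e by exact: sumr_ge0.
have S2 : 0 <= \sum_j F2 j by exact: sumr_ge0.
have S3 : 0 <= \sum_j F3 j by exact: sumr_ge0.
have S4 : 0 <= \sum_j F4 j by exact: sumr_ge0.
have EE : energy ctl b P a w x p =
    \sum_e F1 e + \sum_j F2 j + \sum_j F3 j + \sum_j F4 j.
  by [].
move=> E; rewrite /E EE; split.
- move=> e; have := le_sum_term e F10; rewrite /F1; lra.
- move=> j; have := le_sum_term j F20; rewrite /F2; lra.
- move=> j; have := le_sum_term j F30; rewrite /F3; lra.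
- move=> j; have := le_sum_term j F40; rewrite /F4; lra.
Qed.

(** On the boundary of the well the term of the line concerned is positive, and it takes only two
    values there. A positive [m] below these values for all the lines cannot exceed the energy at
    any configuration touching the boundary. *)
Lemma energy_barrier : exists2 m : R, 0 < m & forall a w x p,
  (forall e, `|a e - angle b e| <= well_radius e) ->
  energy ctl b P a w x p < m ->
  forall e, `|a e - angle b e| < well_radius e.
Proof.
pose G e y : R := suscept nw (val e).1 (val e).2 *
  (cos (angle b e) - cos y - (y - angle b e) * sin (angle b e)).
have r0 e : 0 < well_radius e by rewrite subr_gt0.
have G0 e y : `|y - angle b e| = well_radius e -> 0 < G e y.
  move=> yr; rewrite mulr_gt0 ?line_suscept_gt0// cos_well_gt0//.
    by rewrite yr /well_radius; lra.
  by apply: contraTneq (r0 e) => ye; rewrite -yr ye subrr normr0 ltxx.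
have [m m0 mG] : exists2 m : R, 0 < m & forall e,
    m <= Num.min (G e (angle b e + well_radius e)) (G e (angle b e - well_radius e)).
  apply: finite_lower_bound => e; rewrite lt_min; apply/andP.
  by split; apply: G0; rewrite addrAC subrr add0r ?normrN gtr0_norm.
exists m => // a w x p aR Em e; rewrite lt_neqAle aR andbT; apply/eqP => ar.
have [Ge _ _ _] := @energy_bounds a w x p aR.
have := le_lt_trans (Ge e) Em; apply/negP; rewrite -leNgt.
rewrite -/(G e (a e)); have := mG e; rewrite le_min => /andP[m1 m2].
have [ae|ae] : a e = angle b e + well_radius e \/ a e = angle b e - well_radius e.
- move/eqP: ar; rewrite eqr_norml => /andP[/orP[]/eqP h _]; [left|right];
    by rewrite -(subrK (angle b e) (a e)) h addrC.
- by rewrite ae.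
- by rewrite ae.
Qed.

End EnergyWell.

(** The total demand over the sum of the inverse costs is the Lagrange multiplier [c]. Subtracting
    the terms [c * (p' j - c / q j)], whose sum is 0 by feasibility, leaves the cost difference as a
    sum of squares. *)
Lemma OGR_optimal (R : realType) (g l : nat) (nw : network R g l)
    (q : 'I_g -> R) : (0 < g)%N -> (forall j, 0 < q j) ->
  OGR_minimum nw q
    (fun j => (\sum_n demand nw n) / (\sum_j (q j)^-1) / q j).
Proof.
move=> g0 q0; set d := \sum_n demand nw n; set S := \sum_j (q j)^-1.
have S0 : 0 < S.
  apply: (@lt_le_trans _ _ (q (Ordinal g0))^-1); first by rewrite invr_gt0.
  by apply: le_sum_term => j; rewrite invr_ge0 ltW.
have feas : OGR_feasible nw (fun j => d / S / q j).
  by rewrite /OGR_feasible -mulr_sumr -/S divfK// gt_eqF.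
split=> // p' feas'; rewrite /OGR_cost -subr_ge0 -sumrB.
have s0 : \sum_(j < g) d / S * (p' j - d / S / q j) = 0.
  by rewrite -mulr_sumr sumrB feas' feas subrr mulr0.
rewrite -[leLHS]s0; apply: ler_sum => j _; set c := d / S.
have qj0 : q j != 0 by rewrite gt_eqF.
rewrite -subr_ge0.
have -> : 2^-1 * q j * p' j ^+ 2 - 2^-1 * q j * (c / q j) ^+ 2
    - c * (p' j - c / q j) = 2^-1 * q j * (p' j - c / q j) ^+ 2 by field.
by rewrite mulr_ge0 ?sqr_ge0// mulr_ge0 ?invr_ge0 ?ltW.
Qed.

(** * Solutions near the equilibrium *)

Section Trajectory.

Variables (R : realType) (g l : nat).
Variables (nw : network R g l) (gen : generation R g) (ctl : controller R g).
Variables (b : configuration nw gen) (P : forall j, 'M[R]_(dimx gen j)).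
Variables (hL q : 'I_g -> R).
Implicit Types (e : line nw) (s t : R) (j : 'I_g).
Hypothesis g_gt0 : (0 < g)%N.
Hypothesis b_eq : equilibrium ctl b.
Hypothesis b_angle : forall e, `|angle b e| < pi / 2.
Hypothesis P_posdef : forall j, posdef (P j).
Hypothesis hL_lt : forall j, hL j < damping nw (lshift l j).
Hypothesis design : forall j, negsemidef (design_mx ctl (P j) (hL j)).

Lemma neighbor_gain_gt0 i j : comm ctl j i -> 0 < alpha ctl i j.
Proof. by rewrite comm_sym; exact: alpha_gt0. Qed.

Definition freq_rhs (c : configuration nw gen) j :=
  (inertia nw j)^-1 * (- demand nw (lshift l j) + pM ctl c j
    - damping nw (lshift l j) * freq c (lshift l j) + net_flow c (lshift l j)).

Definition xM_rhs (c : configuration nw gen) j :=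
  mxA gen j *m xM c j + input ctl c j *: mxB gen j.

Definition laplacian (c : configuration nw gen) j :=
  \sum_(i | comm ctl j i) alpha ctl i j * (pc c i - pc c j).

Definition pc_rhs (c : configuration nw gen) j :=
  (gam ctl j)^-1 * (pM ctl c j - static_gain gen j * input ctl c j
    - kf ctl j * freq c (lshift l j) + laplacian c j).

Variable z : R -> configuration nw gen.
Hypothesis z_sol : solution ctl z.

Lemma angle_is_derive e t : 0 < t ->
  is_derive t (1 : R) (fun s => angle (z s) e)
    (freq (z t) (val e).1 - freq (z t) (val e).2).
Proof.
have [_ _ dz] := z_sol; move=> /dz[da _ _ _ [<- _ _ _]].
exact/derivableP.
Qed.

Lemma freq_is_derive j t : 0 < t ->
  is_derive t (1 : R) (fun s => freq (z s) (lshift l j)) (freq_rhs (z t) j).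
Proof.
have [_ _ dz] := z_sol; move=> /dz[_ dw _ _ [_ /(_ j) h _ _]].
by rewrite /freq_rhs -h mulKf ?gt_eqF ?inertia_gt0//; exact/derivableP.
Qed.

Lemma xM_is_derive j i t : 0 < t ->
  is_derive t (1 : R) (fun s => xM (z s) j i 0) (xM_rhs (z t) j i 0).
Proof.
have [_ _ dz] := z_sol; move=> /dz[_ _ /(_ j) dx _ [_ _ /(_ j) h _]].
rewrite /xM_rhs -h derive_mx// mxE; apply: derivableP.
exact: (derivable_mxP _ _ _).1.
Qed.

Lemma pc_is_derive j t : 0 < t ->
  is_derive t (1 : R) (fun s => pc (z s) j) (pc_rhs (z t) j).
Proof.
have [_ _ dz] := z_sol; move=> /dz[_ _ _ dp [_ _ _ /(_ j) h]].
by rewrite /pc_rhs -h mulKf ?gt_eqF ?gam_gt0//; exact/derivableP.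
Qed.

Definition trajectory_energy t := energy ctl b P (angle (z t))
  (fun j => freq (z t) (lshift l j)) (xM (z t)) (pc (z t)).

(** The differential equations hold only at positive times; continuity at 0 is what lets the initial
    energy bound the later ones. *)
Lemma continuous_trajectory_energy :
  {within `[0, +oo[, continuous trajectory_energy}.
Proof.
have [zc _ _] := z_sol; have [ca cw cx cp] := state_coordinates_continuous nw gen.
pose H := subspace [set` `[(0 : R), +oo[].
refine (@continuous_energy _ _ _ _ _ ctl b P _
  (fun t : H => angle (z t)) (fun (t : H) j => freq (z t) (lshift l j))
  (fun t : H => xM (z t)) (fun t : H => pc (z t)) _ _ _ _).
- by move=> e t; apply: continuous_comp (zc t) (ca e _).
- by move=> j t; apply: continuous_comp (zc t) (cw j _).
- by move=> j i t; apply: continuous_comp (zc t) (cx j i _).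
- by move=> j t; apply: continuous_comp (zc t) (cp j _).
Qed.

Lemma continuous_trajectory_angle e :
  {within `[0, +oo[, continuous (fun t => angle (z t) e - angle b e)}.
Proof.
have [zc _ _] := z_sol; have [ca _ _ _] := state_coordinates_continuous nw gen.
move=> t; apply: continuousB; last exact: cst_continuous.
exact: continuous_comp (zc t) (ca e _).
Qed.

Lemma trajectory_energy_is_derive t : 0 < t ->
  exists2 E', is_derive t (1 : R) trajectory_energy E' &
  E' <= - (\sum_j (damping nw (lshift l j) - hL j)
             * (freq (z t) (lshift l j) - freq b (lshift l j)) ^+ 2
        + \sum_k damping nw (rshift g k)
             * (freq (z t) (rshift g k) - freq b (rshift g k)) ^+ 2
        + 2^-1 * \sum_j \sum_(i | comm ctl j i) alpha ctl i j
             * ((pc (z t) i - pc b i) - (pc (z t) j - pc b j)) ^+ 2).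
Proof.
move=> t0.
have cst (c : R) := is_derive_cst c t (1 : R).
have d1 (e : line nw) : is_derive t (1 : R) (fun s =>
    suscept nw (val e).1 (val e).2 * (cos (angle b e) - cos (angle (z s) e)
      - (angle (z s) e - angle b e) * sin (angle b e)))
    ((flow (z t) e - flow b e) * (freq (z t) (val e).1 - freq (z t) (val e).2)).
  have da := angle_is_derive e t0.
  have dc := @is_derive1_comp _ cos _ _ _ _ (is_derive_cos _) da.
  have ds := is_deriveM (is_deriveB da (cst (angle b e))) (cst (sin (angle b e))).
  apply: is_derive_eq (is_deriveZ (suscept nw (val e).1 (val e).2)
    (is_deriveB (is_deriveB (cst (cos (angle b e))) dc) ds)) _.
  by rewrite /flow /GRing.scale/=; ring.
have d2 j : is_derive t (1 : R) (fun s => 2^-1 * inertia nw j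
      * (freq (z s) (lshift l j) - freq b (lshift l j)) ^+ 2)
    (inertia nw j * (freq (z t) (lshift l j) - freq b (lshift l j))
      * freq_rhs (z t) j).
  have dw : is_derive t (1 : R)
      (fun s => freq (z s) (lshift l j) - freq b (lshift l j)) (freq_rhs (z t) j).
    rewrite -[X in is_derive _ _ _ X]subr0.
    exact: is_deriveB (freq_is_derive j t0) _.
  apply: is_derive_eq (is_deriveZ (2^-1 * inertia nw j) (is_deriveM dw dw)) _.
  by rewrite /GRing.scale/=; field.
have d3 j := is_derive_quadform (xM b j) (proj1 (P_posdef j))
  (fun i => @xM_is_derive j i t t0).
have d4 j : is_derive t (1 : R) (fun s => 2^-1 * gam ctl j
      * (pc (z s) j - pc b j) ^+ 2)
    (gam ctl j * (pc (z t) j - pc b j) * pc_rhs (z t) j).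
  have dp : is_derive t (1 : R) (fun s => pc (z s) j - pc b j) (pc_rhs (z t) j).
    rewrite -[X in is_derive _ _ _ X]subr0.
    exact: is_deriveB (pc_is_derive j t0) _.
  apply: is_derive_eq (is_deriveZ (2^-1 * gam ctl j) (is_deriveM dp dp)) _.
  by rewrite /GRing.scale/=; field.
have D := is_deriveD (is_deriveD (is_deriveD
  (is_derive_bigsum (index_enum _) xpredT d1)
  (is_derive_bigsum (index_enum _) xpredT d2))
  (is_derive_bigsum (index_enum _) xpredT d3))
  (is_derive_bigsum (index_enum _) xpredT d4).
eexists; first exact: D.
have [_ zalg _] := z_sol.
apply: (@dissipation _ _ _ _ _ _ b (z t) _ _ _ _ P hL) => //.
- exact: zalg (ltW t0).
- split=> // [k|j] /=.
    by rewrite /freq_rhs mulVKf// gt_eqF// inertia_gt0.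
  by rewrite /pc_rhs mulVKf// gt_eqF// gam_gt0.
- by move=> j; have [] := P_posdef j.
Qed.

Lemma trajectory_energy_nonincreasing s t : 0 <= s -> s <= t ->
  trajectory_energy t <= trajectory_energy s.
Proof.
apply: (@derivative_nonincreasing _ _ ('D_1 trajectory_energy)).
- exact: continuous_trajectory_energy.
- by move=> u /trajectory_energy_is_derive[E' [dE _] _]; exact: derivableP.
move=> u /trajectory_energy_is_derive[E' /@derive_val -> /le_trans]; apply.
rewrite oppr_le0 !addr_ge0 ?mulr_ge0 ?invr_ge0// sumr_ge0// => j _.
- by rewrite mulr_ge0 ?sqr_ge0// subr_ge0 ltW.
- by rewrite mulr_ge0 ?sqr_ge0// ltW// damping_gt0.
- by rewrite sumr_ge0// => i ij; rewrite mulr_ge0 ?sqr_ge0// ltW// neighbor_gain_gt0.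
Qed.

(** * Bounds on a trajectory confined to the well *)

Variable m : R.
Hypothesis z_energy : forall t, 0 <= t -> trajectory_energy t <= m.
Hypothesis z_near : forall t, 0 <= t -> forall e,
  `|angle (z t) e - angle b e| < well_radius b e.

Let z_bounds t (t0 : 0 < t) := energy_bounds ctl P_posdef
  (fun j => freq (z t) (lshift l j)) (xM (z t)) (pc (z t))
  (fun e => ltW (z_near (ltW t0) e)).

Lemma generator_freq_bounded j : bounded_pos (fun t => freq (z t) (lshift l j)).
Proof.
apply: (@bounded_pos_square _ _ (freq b (lshift l j)) (2^-1 * inertia nw j) m).
  by rewrite mulr_gt0// inertia_gt0.
move=> t t0; have [_ + _ _] := z_bounds t0 => /(_ j)/le_trans; apply.
exact/z_energy/ltW.
Qed.

Lemma pc_bounded j : bounded_pos (fun t => pc (z t) j).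
Proof.
apply: (@bounded_pos_square _ _ (pc b j) (2^-1 * gam ctl j) m).
  by rewrite mulr_gt0// gam_gt0.
move=> t t0; have [_ _ _ +] := z_bounds t0 => /(_ j)/le_trans; apply.
exact/z_energy/ltW.
Qed.

Lemma xM_bounded j i : bounded_pos (fun t => xM (z t) j i 0).
Proof.
have [c c0 cP] := posdef_coord i (P_posdef j).
apply: (@bounded_pos_square _ _ (xM b j i 0) 1 (c * (2 * m))) => // t t0.
have [_ _ /(_ j) xm _] := z_bounds t0.
have -> : xM (z t) j i 0 - xM b j i 0 = (xM (z t) j - xM b j) i 0 by rewrite !mxE.
rewrite mul1r (le_trans (cP _))//.
rewrite ler_pM2l// -ler_pdivrMl// (le_trans xm)//; exact/z_energy/ltW.
Qed.

Lemma angle_bounded e : bounded_pos (fun t => angle (z t) e).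
Proof.
exists (`|angle b e| + well_radius b e) => t t0.
rewrite -[angle (z t) e](subrK (angle b e)) addrC (le_trans (ler_normD _ _))//.
by rewrite lerD2l; exact/ltW/z_near/ltW.
Qed.

Lemma flow_bounded e : bounded_pos (fun t => flow (z t) e).
Proof.
apply: bounded_posM; first exact: bounded_pos_cst.
by exists 1 => t _; rewrite ler_norml sin_geN1 sin_le1.
Qed.

Lemma net_flow_bounded n : bounded_pos (fun t => net_flow (z t) n).
Proof.
apply: bounded_posD; first apply: bounded_posN.
all: by apply: bounded_pos_sum => e; exact: flow_bounded.
Qed.

(** The algebraic equation expresses these frequencies through the line flows, so their bounds and
    derivatives come from those of the angles. *)
Lemma load_freqE k t : 0 < t -> (damping nw (rshift g k))^-1
    * (net_flow (z t) (rshift g k) - demand nw (rshift g k))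
  = freq (z t) (rshift g k).
Proof.
have [_ zalg _] := z_sol; move=> /ltW/zalg/(_ k)/= h.
rewrite (_ : net_flow (z t) _ - _ =
  damping nw (rshift g k) * freq (z t) (rshift g k)); last by lra.
by rewrite mulKf// gt_eqF// damping_gt0.
Qed.

Lemma freq_bounded n : bounded_pos (fun t => freq (z t) n).
Proof.
case: (split_ordP n) => [j ->|k ->]; first exact: generator_freq_bounded.
have [K nK] : bounded_pos (fun t => (damping nw (rshift g k))^-1
    * (net_flow (z t) (rshift g k) - demand nw (rshift g k))).
  apply: bounded_posM; first exact: bounded_pos_cst.
  apply: bounded_posD; [exact: net_flow_bounded|exact: bounded_pos_cst].
by exists K => t t0; rewrite -load_freqE// nK.
Qed.

Lemma angle_tame e : tame (fun t => angle (z t) e).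
Proof.
apply: tameI (angle_bounded e) (fun t => @angle_is_derive e t) _.
by apply: bounded_posD; [|apply: bounded_posN]; exact: freq_bounded.
Qed.

Lemma net_flow_tame n : tame (fun t => net_flow (z t) n).
Proof.
have ft e : tame (fun t => flow (z t) e).
  by apply: tameM; [exact: tame_cst|exact/tame_sin/angle_tame].
by apply: tameD; [apply: tameN|]; apply: tame_sum => e; exact: ft.
Qed.

Lemma load_freq_tame k : tame (fun t => freq (z t) (rshift g k)).
Proof.
apply: eq_tame (@load_freqE k) _; apply: tameM; first exact: tame_cst.
by apply: tameD; [exact: net_flow_tame|exact: tame_cst].
Qed.

Lemma input_bounded j : bounded_pos (fun t => input ctl (z t) j).
Proof.
apply: bounded_posD; [|apply: bounded_posN]; apply: bounded_posM.
all: first [exact: bounded_pos_cst|exact: pc_bounded|exact: freq_bounded].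
Qed.

Lemma pM_sumE (c : configuration nw gen) j : pM ctl c j =
  \sum_k mxC gen j 0 k * xM c j k 0 + mxD gen j * input ctl c j.
Proof. by rewrite /pM mxE. Qed.

Lemma pM_bounded j : bounded_pos (fun t => pM ctl (z t) j).
Proof.
under eq_fun do rewrite pM_sumE.
apply: bounded_posD; last first.
  by apply: bounded_posM; [exact: bounded_pos_cst|exact: input_bounded].
apply: bounded_pos_sum => k.
by apply: bounded_posM; [exact: bounded_pos_cst|exact: xM_bounded].
Qed.

Lemma generator_freq_tame j : tame (fun t => freq (z t) (lshift l j)).
Proof.
apply: tameI (freq_bounded _) (fun t => @freq_is_derive j t) _.
apply: bounded_posM; first exact: bounded_pos_cst.
apply: bounded_posD; last exact: net_flow_bounded.
apply: bounded_posD.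
  by apply: bounded_posD; [exact: bounded_pos_cst|exact: pM_bounded].
apply: bounded_posN; apply: bounded_posM; first exact: bounded_pos_cst.
exact: freq_bounded.
Qed.

Lemma freq_tame n : tame (fun t => freq (z t) n).
Proof.
case: (split_ordP n) => [j ->|k ->]; first exact: generator_freq_tame.
exact: load_freq_tame.
Qed.

Lemma xM_tame j i : tame (fun t => xM (z t) j i 0).
Proof.
apply: tameI (xM_bounded i) (fun t => @xM_is_derive j i t) _.
have -> : (fun t => xM_rhs (z t) j i 0) = fun t =>
    \sum_k mxA gen j i k * xM (z t) j k 0 + input ctl (z t) j * mxB gen j i 0.
  by apply/funext => t; rewrite !mxE.
apply: bounded_posD; last first.
  by apply: bounded_posM; [exact: input_bounded|exact: bounded_pos_cst].
apply: bounded_pos_sum => k.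
by apply: bounded_posM; [exact: bounded_pos_cst|exact: xM_bounded].
Qed.

Lemma pc_tame j : tame (fun t => pc (z t) j).
Proof.
apply: tameI (pc_bounded j) (fun t => @pc_is_derive j t) _.
apply: bounded_posM; first exact: bounded_pos_cst.
apply: bounded_posD; last first.
  apply: bounded_pos_sum => i; apply: bounded_posM; first exact: bounded_pos_cst.
  by apply: bounded_posD; [|apply: bounded_posN]; exact: pc_bounded.
apply: bounded_posD; [apply: bounded_posD|]; [exact: pM_bounded| |].
all: apply: bounded_posN; apply: bounded_posM; first exact: bounded_pos_cst.
- exact: input_bounded.
- exact: freq_bounded.
Qed.

Lemma input_tame j : tame (fun t => input ctl (z t) j).
Proof.
apply: tameB; apply: tameM; [exact: tame_cst|exact: pc_tame| |].
- exact: tame_cst.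
- exact: freq_tame.
Qed.

Lemma pM_tame j : tame (fun t => pM ctl (z t) j).
Proof.
under eq_fun do rewrite pM_sumE.
apply: tameD; last by apply: tameM; [exact: tame_cst|exact: input_tame].
by apply: tame_sum => k; apply: tameM; [exact: tame_cst|exact: xM_tame].
Qed.

Lemma freq_rhs_tame j : tame (fun t => freq_rhs (z t) j).
Proof.
apply: tameM; first exact: tame_cst.
apply: tameD; last exact: net_flow_tame.
apply: tameB; first by apply: tameD; [exact: tame_cst|exact: pM_tame].
by apply: tameM; [exact: tame_cst|exact: freq_tame].
Qed.

Lemma pc_rhs_tame j : tame (fun t => pc_rhs (z t) j).
Proof.
apply: tameM; first exact: tame_cst.
apply: tameD; last first.
  apply: tame_sum => i; apply: tameM; first exact: tame_cst.
  by apply: tameB; exact: pc_tame.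
apply: tameB; last by apply: tameM; [exact: tame_cst|exact: freq_tame].
apply: tameB; first exact: pM_tame.
by apply: tameM; [exact: tame_cst|exact: input_tame].
Qed.

(** Splits the dissipation into its nonnegative terms, each dominated by the derivative of minus the
    energy, which is the form that [square_cvg0] takes. *)
Lemma energy_decay t : 0 < t ->
  exists2 E', is_derive t (1 : R) (fun s => - trajectory_energy s) E' &
  [/\ forall j, (damping nw (lshift l j) - hL j)
        * (freq (z t) (lshift l j) - freq b (lshift l j)) ^+ 2 <= E',
      forall k, damping nw (rshift g k)
        * (freq (z t) (rshift g k) - freq b (rshift g k)) ^+ 2 <= E'
    & forall i j, comm ctl j i -> 2^-1 * alpha ctl i j
        * ((pc (z t) i - pc b i) - (pc (z t) j - pc b j)) ^+ 2 <= E'].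
Proof.
move=> /trajectory_energy_is_derive[E' dE].
set F1 := fun j => (damping nw (lshift l j) - hL j)
        * (freq (z t) (lshift l j) - freq b (lshift l j)) ^+ 2.
set F2 := fun k => damping nw (rshift g k)
        * (freq (z t) (rshift g k) - freq b (rshift g k)) ^+ 2.
set F3 := fun j i => alpha ctl i j
        * ((pc (z t) i - pc b i) - (pc (z t) j - pc b j)) ^+ 2.
have F10 j : 0 <= F1 j by rewrite mulr_ge0 ?sqr_ge0// subr_ge0 ltW.
have F20 k : 0 <= F2 k by rewrite mulr_ge0 ?sqr_ge0// ltW// damping_gt0.
have F30 j i : comm ctl j i -> 0 <= F3 j i.
  by move=> ij; rewrite mulr_ge0 ?sqr_ge0// ltW// neighbor_gain_gt0.
have F40 j : 0 <= \sum_(i | comm ctl j i) F3 j i by apply: sumr_ge0 => i ij; exact: F30.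
have S1 : 0 <= \sum_j F1 j by apply: sumr_ge0 => j _; exact: F10.
have S2 : 0 <= \sum_k F2 k by apply: sumr_ge0 => k _; exact: F20.
have S3 : 0 <= \sum_j \sum_(i | comm ctl j i) F3 j i.
  by apply: sumr_ge0 => j _; exact: F40.
rewrite -/(\sum_j F1 j) -/(\sum_k F2 k)
  -/(\sum_j \sum_(i | comm ctl j i) F3 j i) => E'le.
exists (- E'); first exact: is_deriveN.
split=> [j|k|i j ij].
- have := le_sum_term j F10; rewrite /F1; lra.
- have := le_sum_term k F20; rewrite /F2; lra.
have := le_sum_term j F40.
have : F3 j i <= \sum_(i | comm ctl j i) F3 j i.
  by rewrite (bigD1 i)//= lerDl sumr_ge0// => i' /andP[/F30].
rewrite -mulrA -/(F3 j i); lra.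
Qed.

(** * Asymptotic behavior of the trajectory *)

Lemma trajectory_energy_cvg :
  exists L : R, (- trajectory_energy t) @[t --> +oo] --> L.
Proof.
have [L EL] : exists L : R, trajectory_energy t @[t --> +oo] --> L.
  apply: (@nonincreasing_cvg _ _ 0) => [s t|t t0].
    exact: trajectory_energy_nonincreasing.
  (* The controller term of one generator bus is nonnegative and bounds the energy from below. *)
  have [_ _ _ /(_ (Ordinal g_gt0))] := energy_bounds ctl P_posdef
    (fun j => freq (z t) (lshift l j)) (xM (z t)) (pc (z t))
    (fun e => ltW (z_near t0 e)).
  apply: le_trans.
  by rewrite mulr_ge0 ?sqr_ge0// mulr_ge0 ?invr_ge0// ltW// gam_gt0.
by exists (- L); exact: limN.
Qed.

Lemma freq_cvg n : freq (z t) n @[t --> +oo] --> 0.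
Proof.
have [L EL] := trajectory_energy_cvg.
have wt : tame (fun t => freq (z t) n - freq b n).
  by apply: tameB; [exact: freq_tame|exact: tame_cst].
have : (freq (z t) n - freq b n) @[t --> +oo] --> 0.
  move: wt; case: (split_ordP n) => [j ->|k ->] wt.
  - apply: (square_cvg0 _ EL wt (c := damping nw (lshift l j) - hL j)).
      by rewrite subr_gt0.
    by move=> t /energy_decay[E' dE [/(_ j)]]; exists E'.
  - apply: (square_cvg0 _ EL wt (c := damping nw (rshift g k))).
      exact: damping_gt0.
    by move=> t /energy_decay[E' dE [_ /(_ k)]]; exists E'.
rewrite (equilibrium_freq0 n g_gt0 b_eq).
by apply: eq_lim => // t _; rewrite subr0.
Qed.

(** At the equilibrium the graph Laplacian of [pc b] vanishes, hence so does its quadratic form,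
    which forces equality across each communication edge. Differences of deviations in
    [energy_decay] are therefore differences of [pc] itself. *)
Lemma equilibrium_pc_eq i j : pc b i = pc b j.
Proof.
apply: connect_eq (comm_connected ctl i j) => {}i {}j ij.
have [_ [_ _ _ bp]] := b_eq.
have lap0 k : laplacian b k = 0.
  have := bp k; rewrite mulr0 equilibrium_pM// subrr (equilibrium_freq0 _ g_gt0 b_eq).
  by rewrite mulr0 sub0r oppr0 add0r /laplacian => <-.
have := sum_weighted_laplacian (comm_sym ctl) (@alpha_sym _ _ ctl) (pc b) (pc b).
rewrite big1 => [/esym/eqP|k _]; last by rewrite -/(laplacian b k) lap0 mulr0.
have F0 k k' : comm ctl k k' ->
    0 <= alpha ctl k' k * ((pc b k' - pc b k) * (pc b k' - pc b k)).
  by move=> kk'; rewrite -expr2 mulr_ge0 ?sqr_ge0// ltW// neighbor_gain_gt0.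
rewrite oppr_eq0 mulf_eq0 invr_eq0 pnatr_eq0/= psumr_eq0 => [|k _]; last first.
  by apply: sumr_ge0 => k' kk'; exact: F0.
move=> /allP/(_ i); rewrite mem_index_enum => /(_ isT)/=.
rewrite psumr_eq0; last exact: F0.
move=> /allP/(_ j); rewrite mem_index_enum => /(_ isT); rewrite ij/=.
rewrite mulf_eq0 gt_eqF ?neighbor_gain_gt0//= -expr2 sqrf_eq0 subr_eq0.
by move/eqP.
Qed.

(** Energy dissipation settles the case of neighbors; limits are then added along a communication
    path. *)
Lemma pc_diff_cvg i j : (pc (z t) i - pc (z t) j) @[t --> +oo] --> 0.
Proof.
have [L EL] := trajectory_energy_cvg.
have adj k k' : comm ctl k' k -> (pc (z t) k - pc (z t) k') @[t --> +oo] --> 0.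
  move=> kk'.
  have wt : tame (fun t => pc (z t) k - pc (z t) k').
    by apply: tameB; exact: pc_tame.
  apply: (square_cvg0 _ EL wt (c := 2^-1 * alpha ctl k k')).
    by rewrite mulr_gt0// neighbor_gain_gt0.
  move=> t /energy_decay[E' dE [_ _ /(_ k k' kk')]]; exists E' => //.
  rewrite (_ : pc (z t) k - pc (z t) k' =
    (pc (z t) k - pc b k) - (pc (z t) k' - pc b k'))//.
  by rewrite (equilibrium_pc_eq k k'); ring.
have /connectP[p + ->] := comm_connected ctl j i.
elim: p j => [|k p IH] j /=.
  move=> _; apply: (@eq_lim _ (fun=> 0) _ 0) => [t _||]; rewrite ?subrr//.
  exact: cvg_cst.
move=> /andP[jk /IH h].
by apply: (eq_lim _ _ (limD h (adj _ _ jk))); [move=> t _; ring|rewrite addr0].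
Qed.

Lemma freq_rhs_cvg j : freq_rhs (z t) j @[t --> +oo] --> 0.
Proof.
apply: (derivative_cvg0 (freq_cvg (lshift l j))); first exact: freq_rhs_tame.
by move=> t t0; exact: freq_is_derive.
Qed.

Lemma pc_rhs_diff_cvg i j : (pc_rhs (z t) i - pc_rhs (z t) j) @[t --> +oo] --> 0.
Proof.
apply: (derivative_cvg0 (pc_diff_cvg i j)).
  by apply: tameB; exact: pc_rhs_tame.
by move=> t t0; apply: is_deriveB; exact: pc_is_derive.
Qed.

(** Adding the balance equations of all the buses cancels the line flows. The total generation then
    equals the total demand plus accelerations and damping terms, all tending to 0. *)
Lemma sum_pM_cvg :
  (\sum_j pM ctl (z t) j) @[t --> +oo] --> \sum_n demand nw n.
Proof.
pose h t := \sum_n demand nw n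
  + (\sum_j (inertia nw j * freq_rhs (z t) j
             + damping nw (lshift l j) * freq (z t) (lshift l j))
     + \sum_k damping nw (rshift g k) * freq (z t) (rshift g k)).
have h1 j : (inertia nw j * freq_rhs (z t) j
    + damping nw (lshift l j) * freq (z t) (lshift l j)) @[t --> +oo] -->
    inertia nw j * 0 + damping nw (lshift l j) * 0.
  exact: (limD (@lim_scale _ (inertia nw j) _ _ (freq_rhs_cvg j))
    (@lim_scale _ (damping nw (lshift l j)) _ _ (freq_cvg (lshift l j)))).
have h2 k : (damping nw (rshift g k) * freq (z t) (rshift g k)) @[t --> +oo] -->
    damping nw (rshift g k) * 0.
  exact: (@lim_scale _ (damping nw (rshift g k)) _ _ (freq_cvg (rshift g k))).
have hl := limD (@lim_cst _ (\sum_n demand nw n)) (limD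
  (lim_sum h1) (lim_sum h2)).
apply: (eq_lim _ _ hl) => [t t0|]; last first.
  rewrite [X in _ + (X + _)]big1 => [|j _]; last by rewrite !mulr0 addr0.
  by rewrite [X in _ + (_ + X)]big1 ?addr0// => k _; rewrite mulr0.
have nf0 : \sum_n net_flow (z t) n = 0.
  have := sum_net_flow (z t) (fun=> 1).
  under eq_bigr do rewrite mul1r; move=> ->.
  by rewrite big1 ?oppr0// => e _; rewrite subrr mulr0.
have eG : \sum_j (inertia nw j * freq_rhs (z t) j
    + damping nw (lshift l j) * freq (z t) (lshift l j)) =
    \sum_j pM ctl (z t) j - \sum_j demand nw (lshift l j)
    + \sum_j net_flow (z t) (lshift l j).
  rewrite -sumrB -big_split/=; apply: eq_bigr => j _.
  by rewrite /freq_rhs mulVKf ?gt_eqF ?inertia_gt0//; ring.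
have eL : \sum_k damping nw (rshift g k) * freq (z t) (rshift g k) =
    \sum_k net_flow (z t) (rshift g k) - \sum_k demand nw (rshift g k).
  rewrite -sumrB; apply: eq_bigr => k _.
  by have [_ /(_ _ (ltW t0))/(_ k)/= h0 _] := z_sol; lra.
move: nf0; rewrite eG eL !big_split_ord/=; lra.
Qed.

Hypothesis kc_gain : forall j, static_gain gen j * kc ctl j = (q j)^-1.
Hypothesis q_gt0 : forall j, 0 < q j.

Lemma pM_cvg j : pM ctl (z t) j @[t --> +oo] -->
  (\sum_n demand nw n) / (\sum_i (q i)^-1) / q j.
Proof.
pose j0 := Ordinal g_gt0.
pose v t := pc_rhs (z t) j0; pose c t := pc (z t) j0.
(* One bus [j0] serves as reference; [r i] collects all that tends to 0 when the controller equation
   of bus [i] is rewritten with [v] and [c] in place of its own [pc_rhs] and [pc]. *)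
pose r i t := gam ctl i * (pc_rhs (z t) i - v t) + (q i)^-1 * (pc (z t) i - c t)
  + (kf ctl i - static_gain gen i * kd ctl i) * freq (z t) (lshift l i)
  - \sum_(k | comm ctl i k) alpha ctl k i * (pc (z t) k - pc (z t) i).
have pME i t : pM ctl (z t) i = gam ctl i * v t + (q i)^-1 * c t + r i t.
  have h : gam ctl i * pc_rhs (z t) i = pM ctl (z t) i
      - static_gain gen i * input ctl (z t) i
      - kf ctl i * freq (z t) (lshift l i) + laplacian (z t) i.
    by rewrite /pc_rhs mulVKf// gt_eqF// gam_gt0.
  have hi : static_gain gen i * input ctl (z t) i = (q i)^-1 * pc (z t) i
      - static_gain gen i * kd ctl i * freq (z t) (lshift l i).
    by rewrite /input mulrBr !mulrA kc_gain.
  move: h; rewrite hi /r -/(laplacian (z t) i); lra.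
have r0 i : r i t @[t --> +oo] --> 0.
  have lim0 (a : R) (f : R -> R) : f t @[t --> +oo] --> 0 ->
      (a * f t) @[t --> +oo] --> 0.
    by move=> f0; rewrite -(mulr0 a); exact: (@lim_scale _ a _ _ f0).
  have lap0 : (\sum_(k | comm ctl i k) alpha ctl k i * (pc (z t) k - pc (z t) i))
      @[t --> +oo] --> \sum_(k | comm ctl i k) (0 : R).
    by apply: cvgr_sum => k; apply: lim0; exact: pc_diff_cvg.
  have := limD (limD (limD (lim0 (gam ctl i) _ (pc_rhs_diff_cvg i j0))
    (lim0 ((q i)^-1) _ (pc_diff_cvg i j0)))
    (lim0 (kf ctl i - static_gain gen i * kd ctl i) _ (freq_cvg (lshift l i))))
    (limN lap0).
  by rewrite big1// oppr0 !addr0.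
pose S := \sum_i (q i)^-1; pose G := \sum_i gam ctl i.
have S0 : 0 < S.
  apply: (@lt_le_trans _ _ (q j0)^-1); first by rewrite invr_gt0.
  by apply: le_sum_term => i; rewrite invr_ge0 ltW.
have G0 : 0 < G.
  apply: (@lt_le_trans _ _ (gam ctl j0)); first exact: gam_gt0.
  by apply: le_sum_term => i; rewrite ltW// gam_gt0.
have sr : (\sum_i r i t) @[t --> +oo] --> \sum_(i < g) (0 : R).
  exact: lim_sum.
(* Summing [pME] over the buses and dividing by [G] gives a stable scalar equation for [c], whose
   derivative is [v]. *)
have ode : (v t + S / G * c t) @[t --> +oo] --> (\sum_n demand nw n) / G.
  apply: (eq_lim _ _ (limM (limD sum_pM_cvg (limN sr)) (@lim_cst _ (G^-1)))).
    move=> t _; under eq_bigr do rewrite pME.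
    rewrite !big_split/= -!mulr_suml -/S -/G addrK.
    by field; rewrite gt_eqF.
  by rewrite [X in _ - X]big1// oppr0 addr0.
have cl : c t @[t --> +oo] --> (\sum_n demand nw n) / S.
  have -> : (\sum_n demand nw n) / S = (\sum_n demand nw n) / G / (S / G).
    by field; rewrite !gt_eqF.
  apply: linear_ode_cvg ode; first by rewrite divr_gt0.
  by move=> t t0; exact: pc_is_derive.
have vl : v t @[t --> +oo] --> 0.
  apply: (derivative_cvg0 cl); first exact: pc_rhs_tame.
  by move=> t t0; exact: pc_is_derive.
apply: (eq_lim _ _ (limD (limD (@lim_scale _ (gam ctl j) _ _ vl)
  (@lim_scale _ ((q j)^-1) _ _ cl)) (r0 j))) => [t _|]; first by rewrite -pME.
by rewrite mulr0 add0r addr0 mulrC.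
Qed.

End Trajectory.

Theorem theorem1 (R : realType) (g l : nat) (g_gt0 : (0 < g)%N)
    (nw : network R g l) (gen : generation R g) (ctl : controller R g)
    (q : 'I_g -> R) (q_gt0 : forall j, 0 < q j)
    (b : configuration nw gen)
    (b_eq : equilibrium ctl b)
    (b_angle : forall e, `|angle b e| < pi / 2)
    (design : forall j, design_condition nw gen ctl j)
    (kcE : forall j, kc ctl j = 1 / (q j * static_gain gen j)) :
  exists U : set (state nw gen),
    [/\ open U, U (state_of b)
      & forall z : R -> configuration nw gen,
          solution ctl z -> U (state_of (z 0)) ->
          (exists2 p : 'I_g -> R, OGR_minimum nw q p
             & forall j, pM ctl (z t) j @[t --> +oo] --> p j)
          /\ (forall j, freq (z t) j @[t --> +oo] --> 0)].
Proof.
pose P j := projT1 (cid (design j)).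
pose hL j := projT1 (cid (projT2 (cid (design j)))).
have dP j : [/\ posdef (P j), hL j < damping nw (lshift l j)
    & negsemidef (design_mx ctl (P j) (hL j))].
  exact: projT2 (cid (projT2 (cid (design j)))).
have P_posdef j : posdef (P j) by have [] := dP j.
have hL_lt j : hL j < damping nw (lshift l j) by have [] := dP j.
have dmx j : negsemidef (design_mx ctl (P j) (hL j)) by have [] := dP j.
have kc_gain j : static_gain gen j * kc ctl j = (q j)^-1.
  (* Division by 0 yields 0, so a zero static gain would make [kc] vanish against its positivity. *)
  have K0 : static_gain gen j != 0.
    apply/eqP => K0; have := kc_gt0 ctl j.
    by rewrite kcE K0 mulr0 invr0 mulr0 ltxx.
  by rewrite kcE; field; rewrite K0 gt_eqF.
have [m m0 barrier] := energy_barrier ctl b_angle P_posdef.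
have [ca cw cx cp] := state_coordinates_continuous nw gen.
have cE := @continuous_energy _ _ _ _ _ ctl b P _ _ _ _ _ ca cw cx cp.
(* The barrier speaks only of angles inside the well, so the sublevel set is intersected with the
   well. *)
exists ([set s : state nw gen | energy ctl b P s.1.1.1 s.1.1.2 s.1.2 s.2 < m]
  `&` [set s | forall e, `|s.1.1.1 e - angle b e| < well_radius b e]).
split.
- apply: openI; first exact: open_sublevel cE.
  exact: open_forall_dist_lt ca.
- by split=> /=; rewrite ?energy_eq0// => e; rewrite subrr normr0 subr_gt0.
move=> z z_sol [/= z0E z0r].
have zE t : 0 <= t -> trajectory_energy ctl b P z t < m.
  move=> t0; apply: le_lt_trans z0E.
  exact: (trajectory_energy_nonincreasing b_eq P_posdef hL_lt dmx z_sol (lexx 0) t0).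
(* The energy stays below [m], so the barrier makes weak confinement strict, which is what [trapped]
   asks for. *)
have zr t : 0 <= t -> forall e, `|angle (z t) e - angle b e| < well_radius b e.
  apply: (trapped (h := fun e t => angle (z t) e - angle b e)) => //.
    by move=> e; exact: continuous_trajectory_angle z_sol e.
  by move=> u u0 ur; exact: barrier ur (zE _ u0).
have zEm t (t0 : 0 <= t) := ltW (zE t t0).
split=> [|n].
  exists (fun j => (\sum_n demand nw n) / (\sum_i (q i)^-1) / q j).
    exact: OGR_optimal.
  move=> j; exact: (pM_cvg g_gt0 b_eq P_posdef hL_lt dmx z_sol zEm zr kc_gain q_gt0).
exact: (freq_cvg g_gt0 b_eq P_posdef hL_lt dmx z_sol zEm zr).
Qed.
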